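(* Let $L$ be a real-valued functional defined on the finite subsets of $[0,1]^2$, and assume that for a certain constant $\kappa$ the following regularity condition holds: whenever $k\ge1$, $C\in\mathcal C_k$, $F\subset[0,1]^2$ is finite and such that each $C'\in\mathcal C_{k-1}$ that is within distance $2^{-k+5}$ of $C$ meets $F$, and $G\subset C$ is finite, then $$|L(F\cup G)-L(F)|\le\kappa2^{-k}\sqrt{\mathrm{card}\,G}.$$ Then there is a constant $K$ depending only on $\kappa$ such that, for every $N\ge1$, if $X_1,\dots,X_N$ are independent and uniformly distributed over $[0,1]^2$, the random variable $L_N=L(\{X_1,\dots,X_N\})$ satisfies $$\forall t\ge0,\qquad P(|L_N-M|\ge t)\le Ke^{-t^2/K},$$ where $M$ is a median of $L_N$.
   Context: For $k\ge0$, $\mathcal C_k$ denotes the family of the $2^{2k}$ dyadic squares of side $2^{-k}$ contained in $[0,1]^2$, i.e. those whose vertices are of the form $(\ell_12^{-k},\ell_22^{-k})$ with integers $0\le\ell_1,\ell_2\le2^k$ (so $\mathcal C_0=\{[0,1]^2\}$). Distances are Euclidean. All functions are treated as measurable. *)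

(* Defs.v *)
From HB Require Import structures.
From mathcomp Require Import all_boot all_order all_algebra finmap.
From mathcomp Require Import all_classical all_reals all_analysis.

Set Implicit Arguments.
Unset Strict Implicit.
Unset Printing Implicit Defensive.

Import Order.TTheory GRing.Theory Num.Theory.
Import numFieldNormedType.Exports.

Local Open Scope classical_set_scope.
Local Open Scope ring_scope.

Definition unit_square (R : realType) : set (R * R) :=
  `[0%R, 1%R]%classic `*` `[0%R, 1%R]%classic.
Arguments unit_square : clear implicits.

Definition dyadic_square (R : realType) (k i j : nat) : set (R * R) :=
  `[i%:R * 2 ^- k, i.+1%:R * 2 ^- k]%classic `*`
  `[j%:R * 2 ^- k, j.+1%:R * 2 ^- k]%classic.

Arguments dyadic_square : clear implicits.

Definition dyadic_squares (R : realType) (k : nat) : set (set (R * R)) :=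
  [set C | exists i j : nat,
    [/\ (i < 2 ^ k)%N, (j < 2 ^ k)%N & C = dyadic_square R k i j]].
Arguments dyadic_squares : clear implicits.

(* The norm of the library on R * R is the sup norm, hence this definition. *)
Definition euclidean_dist (R : realType) (p q : R * R) : R :=
  Num.sqrt ((p.1 - q.1) ^+ 2 + (p.2 - q.2) ^+ 2).

Definition set_dist (R : realType) (A B : set (R * R)) : R :=
  inf [set euclidean_dist p q | p in A & q in B].

Definition point_set (R : realType) (n : nat) (x : 'I_n -> R * R) :
    {fset R * R} := [fset x i | i in 'I_n]%fset.

(* Functionals are total on {fset R * R}; only their values on finite subsets
   of the unit square are ever constrained. *)
Definition dyadic_regular (R : realType) (kappa : R) (L : {fset R * R} -> R) :
    Prop :=
  forall (k : nat) (C : set (R * R)) (F G : {fset R * R}),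
    (1 <= k)%N ->
    dyadic_squares R k C ->
    [set` F] `<=` unit_square R ->
    (forall C' : set (R * R), dyadic_squares R k.-1 C' ->
      set_dist C' C <= 2 ^ (- k%:Z + 5) -> C' `&` [set` F] !=set0) ->
    [set` G] `<=` C ->
    `|L (F `|` G)%fset - L F| <= kappa * 2 ^ (- k%:Z) * Num.sqrt (#|` G|%fset)%:R.

(* Measurability of a functional of finite sets: for every n, it is a Borel
   function of n points of the unit square (repetitions being allowed). *)
Definition measurable_functional (R : realType) (L : {fset R * R} -> R) :
    Prop :=
  forall n : nat,
    measurable_fun
      [set x : n.-tuple (R * R) | forall i, unit_square R (tnth x i)]
      (fun x => L (point_set (tnth x))).

Definition mutually_independent (d d' : measure_display) (R : realType)
    (T : measurableType d) (U : measurableType d') (P : probability T R)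
    (I : finType) (X : I -> {RV P >-> U}) : Prop :=
  forall (J : {set I}) (B : I -> set U), (forall i, measurable (B i)) ->
    (P (\bigcap_(i in [set` J]) (X i @^-1` B i)) =
     \prod_(i in J) P (X i @^-1` B i))%E.
Arguments mutually_independent {d d' R T U} P {I} X.

(* X takes all its values in the unit square, so that a functional of finite
   subsets of the square can be evaluated on them everywhere, not just a.s. *)
Definition uniform_on_unit_square (d : measure_display) (R : realType)
    (T : measurableType d) (P : probability T R)
    (X : {RV P >-> (R * R)%type}) : Prop :=
  (forall w, unit_square R (X w)) /\
  forall A : set (R * R), measurable A ->
    distribution P X A =
    ((@lebesgue_measure R \x @lebesgue_measure R) (A `&` unit_square R))%E.
Arguments uniform_on_unit_square {d R T} P X.

Definition is_median (d : measure_display) (R : realType)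
    (T : measurableType d) (P : probability T R) (Y : T -> R) (M : R) : Prop :=
  ((2^-1)%:E <= P [set w | (Y w <= M)%R])%E /\
  ((2^-1)%:E <= P [set w | (M <= Y w)%R])%E.

(* Main.v *)
Require Import Defs.
From HB Require Import structures.
From mathcomp Require Import all_boot all_order all_algebra finmap.
From mathcomp Require Import all_classical all_reals all_analysis.
From mathcomp Require Import measurable_realfun zify ring lra.

(* Idea.  Split the sample into halves x and y and resample one half while the
   other stays fixed; by symmetry this controls the difference of L at two
   independent samples, hence its deviation from a median.  Once x is fixed,
   adding a point u costs at most kappa 2^-(j+1) as soon as every cell of level
   j near u meets x.  A deviation of order 2^k is to be shown to have
   probability of order exp (- 4^k).  For this, add to every configuration the
   4^k points of the grid of step 2^-k: this moves L by at most 2 kappa 2^k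
   (regularity at level 1), and from then on a single point costs at most
   kappa 2^-(k+1), which allows exponential moments of order 2^k / (2 kappa).
   The sum over the m resampled points of the mean squared cost is bounded by
   an absolute constant unless x leaves too many cells of some level j > k
   empty, and this has probability at most exp (- 4^k), by the exponential
   moments of the number of empty cells. *)

Set Implicit Arguments.
Unset Strict Implicit.
Unset Printing Implicit Defensive.

Import Order.TTheory GRing.Theory Num.Theory.
Import numFieldNormedType.Exports.

Local Open Scope classical_set_scope.
Local Open Scope ring_scope.

(** * Means of bounded measurable functions *)

(** The obstacle is that a point falling in an empty region may cost much, and how much depends on
    the rest of the sample. Freezing one half makes the bounds on the costs functions of that half
    alone, since further points only fill more cells. Exponential moments enter as the product of
    the means of exp f and exp (- f): this requires no centring, and it is exactly what bounds the
    difference at two independent copies. The outcome bounds P (L_N >= M + t) P (L_N <= M), whose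
    second factor is at least 1/2, so the median is never compared with a mean. Levels are examined
    only up to some P. If the sample is large compared with 4^k, then 4^P is of the order of the
    sample size, so that the cost 2^-P per point left at the finest level is affordable: m 4^-P <=
    1. Otherwise P = k, and the grid alone controls every cost. *)

Definition bdmeas (R : realType) (d : measure_display)
    (T : measurableType d) (g : T -> R) : Prop :=
  measurable_fun setT g /\ exists B, forall x, `|g x| <= B.

Section bdmeas_theory.
Context (R : realType) (d : measure_display) (T : measurableType d).
Implicit Types (g h : T -> R) (P : probability T R).

Lemma bdmeas_cst (c : R) : bdmeas (fun _ : T => c).
Proof. by split; [exact: measurable_cst | exists `|c|]. Qed.

Lemma bdmeasD g h : bdmeas g -> bdmeas h ->
  bdmeas (fun x => g x + h x).
Proof.
move=> [mg [A gA]] [mh [B hB]]; split; first exact: measurable_funD.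
by exists (A + B) => x; rewrite (le_trans (ler_normD _ _))// lerD.
Qed.

Lemma bdmeasM g h : bdmeas g -> bdmeas h ->
  bdmeas (fun x => g x * h x).
Proof.
move=> [mg [A gA]] [mh [B hB]]; split; first exact: measurable_funM.
by exists (A * B) => x; rewrite normrM ler_pM.
Qed.

Lemma bdmeasZ (c : R) g : bdmeas g -> bdmeas (fun x => c * g x).
Proof. exact: (bdmeasM (bdmeas_cst c)). Qed.

Lemma bdmeasMr (c : R) g : bdmeas g -> bdmeas (fun x => g x * c).
Proof. by move=> bg; exact: (bdmeasM bg (bdmeas_cst c)). Qed.

Lemma bdmeasN g : bdmeas g ->
  bdmeas (fun x => - g x).
Proof.
move=> [mg [A gA]]; split; first exact: measurable_funN.
by exists A => x; rewrite normrN.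
Qed.

Lemma bdmeas_comp d' (T' : measurableType d') g (h : T' -> T) :
  bdmeas g -> measurable_fun setT h ->
  bdmeas (fun x => g (h x)).
Proof.
move=> [mg [A gA]] mh; split; first exact: measurableT_comp.
by exists A.
Qed.

Lemma bdmeas_expR g : bdmeas g ->
  bdmeas (fun x => expR (g x)).
Proof.
move=> [mg [A gA]]; split; first exact: measurableT_comp.
exists (expR A) => x; rewrite ger0_norm ?expR_ge0// ler_expR.
exact: le_trans (ler_norm _) _.
Qed.

Lemma bdmeas_bool (p : T -> bool) : measurable_fun setT p ->
  bdmeas (fun x => (p x)%:R : R).
Proof.
move=> mp; split; last by exists 1 => x; case: (p x); rewrite ?normr1 ?normr0.
rewrite (_ : (fun _ => _) = fun x => if p x then 1 else 0); last first.
  by apply/funext => x; case: (p x).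
exact: measurable_fun_ifT.
Qed.

Lemma bdmeas_sum (I : Type) (r : seq I) (p : pred I) (g : I -> T -> R) :
  (forall i, bdmeas (g i)) ->
  bdmeas (fun x => \sum_(i <- r | p i) g i x).
Proof.
move=> bg; elim: r => [|i r IH].
  under eq_fun do rewrite big_nil; exact: bdmeas_cst.
under eq_fun do rewrite big_cons.
by case: (p i) => //; exact: bdmeasD.
Qed.

Lemma bdmeas_integrable P g :
  bdmeas g -> P.-integrable setT (EFin \o g).
Proof.
move=> [mg [A gA]]; apply: measurable_bounded_integrable => //.
  by rewrite (le_lt_trans (probability_le1 _ _))// ltry.
exists A; split; first exact: num_real.
by move=> B AB x _; apply: le_trans (gA x) (ltW AB).
Qed.

Lemma mean_cst P (c : R) : \int[P]_x c = c.
Proof.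
rewrite Rintegral_cst//.
by rewrite (_ : fine _ = 1) ?mulr1//; exact: (congr1 fine (probability_setT P)).
Qed.

Lemma meanD P g h : bdmeas g -> bdmeas h ->
  \int[P]_x (g x + h x) = \int[P]_x g x + \int[P]_x h x.
Proof. by move=> bg bh; rewrite RintegralD//; exact: bdmeas_integrable. Qed.

Lemma meanZ P (c : R) g : bdmeas g ->
  \int[P]_x (c * g x) = c * \int[P]_x g x.
Proof. by move=> bg; rewrite RintegralZl//; exact: bdmeas_integrable. Qed.

Lemma mean_le P g h : bdmeas g -> bdmeas h ->
  (forall x, g x <= h x) -> \int[P]_x g x <= \int[P]_x h x.
Proof.
by move=> bg bh gh; apply: le_Rintegral => //; exact: bdmeas_integrable.
Qed.

Lemma mean_sum P (I : Type) (r : seq I) (p : pred I) (g : I -> T -> R) :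
  (forall i, bdmeas (g i)) ->
  \int[P]_x (\sum_(i <- r | p i) g i x) = \sum_(i <- r | p i) \int[P]_x g i x.
Proof.
move=> bg; elim: r => [|i r IH].
  by rewrite big_nil; under eq_Rintegral do rewrite big_nil; rewrite mean_cst.
rewrite big_cons; under eq_Rintegral do rewrite big_cons.
case: (p i) => //; rewrite meanD ?IH//.
exact: bdmeas_sum.
Qed.

Lemma mean_bool P (p : T -> bool) : measurable_fun setT p ->
  \int[P]_x (p x)%:R = fine (P [set x | p x]).
Proof.
move=> mp; rewrite /Rintegral; congr fine.
rewrite (eq_integral (fun x => (\1_[set x | p x] x)%:E)); last first.
  move=> x _; rewrite indicE; congr (_%:R)%:E.
  by congr nat_of_bool; apply/idP/idP; rewrite inE.
by rewrite integral_indic ?setIT// -[X in measurable X]setTI; exact: mp.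
Qed.

End bdmeas_theory.

Section bounded_fubini.
Context (R : realType) (d d' : measure_display) (T : measurableType d)
  (T' : measurableType d').
Implicit Types (P : probability T R) (Q : probability T' R).

Lemma bdmeas_pair1 (g : T * T' -> R) (x : T) :
  bdmeas g -> bdmeas (fun y => g (x, y)).
Proof. by move=> bg; apply: (bdmeas_comp bg); exact: pair1_measurable. Qed.

Lemma bdmeas_pair2 (g : T * T' -> R) (y : T') :
  bdmeas g -> bdmeas (fun x => g (x, y)).
Proof. by move=> bg; apply: (bdmeas_comp bg); exact: pair2_measurable. Qed.

Let bdmeas_integrable2 P Q (g : T * T' -> R) :
  bdmeas g -> (P \x Q)%E.-integrable setT (EFin \o g).
Proof. exact: (@bdmeas_integrable _ _ _ (P \x Q)%E). Qed.

Lemma integral_EFin (d0 : measure_display) (T0 : measurableType d0)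
    (P0 : probability T0 R) (g : T0 -> R) : bdmeas g ->
  (\int[P0]_x (g x)%:E = (\int[P0]_x g x)%:E)%E.
Proof.
move=> bg; rewrite fineK//; apply: integrable_fin_num => //.
exact: bdmeas_integrable.
Qed.

Lemma bdmeas_mean P Q (g : T * T' -> R) :
  bdmeas g -> bdmeas (fun x => \int[Q]_y g (x, y)).
Proof.
move=> bg; split.
  apply: (measurableT_comp (fine_measurable measurableT)).
  exact: measurable_fubini_F (bdmeas_integrable2 P Q bg).
have [mg [A gA]] := bg; exists A => x.
have bgx := bdmeas_pair1 x bg.
apply: le_trans (le_normr_Rintegral measurableT (bdmeas_integrable Q bgx)) _.
rewrite -(mean_cst Q A); apply: mean_le => //.
- case: bgx => mgx _; split; first exact: measurableT_comp.
  by exists A => y; rewrite normr_id.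
- exact: bdmeas_cst.
Qed.

Lemma mean_swap P Q (g : T * T' -> R) : bdmeas g ->
  \int[P]_x \int[Q]_y g (x, y) = \int[Q]_y \int[P]_x g (x, y).
Proof.
move=> bg; rewrite /Rintegral; congr fine.
have := Fubini (bdmeas_integrable2 P Q bg) => /=.
under eq_integral do rewrite (integral_EFin Q (bdmeas_pair1 _ bg)).
move=> ->; apply: eq_integral => y _.
by rewrite (integral_EFin P (bdmeas_pair2 _ bg)).
Qed.

Lemma mean_product P Q (g : T * T' -> R) : bdmeas g ->
  \int[(P \x Q)%E]_z g z = \int[P]_x \int[Q]_y g (x, y).
Proof.
move=> bg; rewrite [LHS]/Rintegral [RHS]/Rintegral; congr fine.
rewrite -integral12_prod_meas1; last exact: bdmeas_integrable2.
by apply: eq_integral => x _; rewrite /fubini_F /= (integral_EFin Q (bdmeas_pair1 _ bg)).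
Qed.

End bounded_fubini.

Lemma mean_distribution (R : realType) (d d' : measure_display)
    (T : measurableType d) (T' : measurableType d') (P : probability T R)
    (X : {mfun T >-> T'}) (g : T' -> R) : bdmeas g ->
  \int[distribution P X]_y g y = \int[P]_x g (X x).
Proof.
move=> bg; rewrite /Rintegral integral_pushforward ?preimage_setT//.
  by apply/measurable_EFinP; case: bg.
apply: (@bdmeas_integrable _ _ _ P (g \o X)).
exact: bdmeas_comp.
Qed.

Section tuple_power.
Context (R : realType) (d : measure_display) (U : measurableType d).
Variable mu : probability U R.

Definition tuple_cons n (x : U * n.-tuple U) : n.+1.-tuple U :=
  [tuple of x.1 :: x.2].

Lemma measurable_tuple_cons n : measurable_fun setT (@tuple_cons n).
Proof. exact: measurable_cons. Qed.

HB.instance Definition _ n :=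
  isMeasurableFun.Build _ _ _ _ (@tuple_cons n) (@measurable_tuple_cons n).

(** The recursion adds the first coordinate, so that a mean over [n.+1] points is an iterated mean
    over the first point and the others; the inductions below peel off that point. *)
Fixpoint tuple_power n : probability (n.-tuple U) R :=
  match n with
  | 0 => dirac ([tuple] : 0.-tuple U)
  | n.+1 => distribution (mu \x tuple_power n)%E (@tuple_cons n)
  end.

End tuple_power.

(** * Powers of a probability measure *)

Section sequence_mean.
Context (R : realType) (d : measure_display) (U : measurableType d).
Variable mu : probability U R.
Implicit Types (f g : seq U -> R).

(** Integrands are functions of sequences, not of tuples: concatenating halves or inserting a point
    then requires no cast between lengths. *)
Definition mean_pow n f : R := \int[tuple_power mu n]_t f t.

Definition seqmeas n f : Prop := bdmeas (fun t : n.-tuple U => f t).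

Lemma mean_pow0 f : mean_pow 0 f = f [::].
Proof.
rewrite /mean_pow /Rintegral/= integral_dirac//=; first by rewrite indicE in_setT mul1r.
move=> _ Y _; rewrite setTI.
have [Yf|Yf] := pselect (Y (f [::])%:E).
  by rewrite (_ : _ @^-1` _ = setT)//; apply/seteqP; split=> // t _; rewrite /= (tuple0 t).
by rewrite (_ : _ @^-1` _ = set0)//; apply/seteqP; split=> // t; rewrite /= (tuple0 t).
Qed.

Lemma seqmeas_pair n f : seqmeas n.+1 f ->
  bdmeas (fun z : U * n.-tuple U => f (z.1 :: z.2)).
Proof.
by move=> mf; exact: (bdmeas_comp mf (@measurable_tuple_cons _ U n)).
Qed.

Lemma seqmeas_cons n f (u : U) : seqmeas n.+1 f -> seqmeas n (fun s => f (u :: s)).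
Proof. by move=> /seqmeas_pair mf; exact: (bdmeas_pair1 u mf). Qed.

Lemma mean_powS n f : seqmeas n.+1 f ->
  mean_pow n.+1 f = \int[mu]_u mean_pow n (fun s => f (u :: s)).
Proof.
move=> mf; rewrite /mean_pow/= (mean_distribution _ _ mf).
by rewrite (mean_product mu _ (seqmeas_pair mf)).
Qed.

Lemma measurable_cat n m :
  measurable_fun setT (fun z : n.-tuple U * m.-tuple U => [tuple of z.1 ++ z.2]).
Proof.
apply/measurable_fun_tnthP => i.
case: (split_ordP i) => j ->.
- rewrite (_ : _ \o _ = (fun t => tnth t j) \o fst); last first.
    by apply/funext => z /=; rewrite tnth_lshift.
  by apply: measurableT_comp => //; exact: measurable_tnth.
- rewrite (_ : _ \o _ = (fun t => tnth t j) \o snd); last first.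
    by apply/funext => z /=; rewrite tnth_rshift.
  by apply: measurableT_comp => //; exact: measurable_tnth.
Qed.

Lemma seqmeas_cat n m f : seqmeas (n + m) f ->
  bdmeas (fun z : n.-tuple U * m.-tuple U => f (z.1 ++ z.2)).
Proof. by move=> mf; exact: (bdmeas_comp mf (@measurable_cat n m)). Qed.

Lemma seqmeas_mean n m f : seqmeas (n + m) f ->
  seqmeas n (fun s => mean_pow m (fun s' => f (s ++ s'))).
Proof. by move=> /seqmeas_cat mf; exact: (bdmeas_mean (tuple_power mu n) (tuple_power mu m) mf). Qed.

Lemma mean_pow_cat n m f : seqmeas (n + m) f ->
  mean_pow (n + m) f = mean_pow n (fun s => mean_pow m (fun s' => f (s ++ s'))).
Proof.
elim: n f => [|n IH] f mf; first by rewrite mean_pow0.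
rewrite (mean_powS (n := n + m) mf) (mean_powS (seqmeas_mean mf)).
by apply: eq_Rintegral => u _; rewrite IH//; exact: (seqmeas_cons (n := n + m)).
Qed.

Lemma seqmeas_prod n (g : U -> R) : bdmeas g ->
  seqmeas n (fun s => \prod_(u <- s) g u).
Proof.
move=> bg; rewrite /seqmeas; elim: n => [|n IH].
  rewrite (_ : (fun _ => _) = fun=> 1); first exact: bdmeas_cst.
  by apply/funext => t; rewrite (tuple0 t) big_nil.
rewrite (_ : (fun _ => _) = fun t : n.+1.-tuple U =>
    g (thead t) * \prod_(u <- [tuple of behead t]) g u); last first.
  by apply/funext => t; rewrite [in LHS](tuple_eta t) big_cons.
apply: bdmeasM; first by apply: bdmeas_comp => //; exact: measurable_tnth.
exact: (bdmeas_comp IH (@measurable_behead _ U n)).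
Qed.

Lemma mean_pow_prod n (g : U -> R) : bdmeas g ->
  mean_pow n (fun s => \prod_(u <- s) g u) = (\int[mu]_u g u) ^+ n.
Proof.
move=> bg; elim: n => [|n IH]; first by rewrite mean_pow0 big_nil.
rewrite mean_powS; last exact: seqmeas_prod.
rewrite exprS -IH mulrC -RintegralZl//; last exact: bdmeas_integrable.
apply: eq_Rintegral => u _; under [LHS]eq_Rintegral do rewrite big_cons.
by rewrite mulrC (meanZ _ _ (seqmeas_prod n bg)).
Qed.

Lemma tuple_power_box n (A : nat -> set U) : (forall i, measurable (A i)) ->
  tuple_power mu n [set t | forall i : 'I_n, A i (tnth t i)] =
  (\prod_(i < n) mu (A i))%E.
Proof.
elim: n A => [|n IH] A mA.
  rewrite big_ord0 /= diracE mem_set//=; by case.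
rewrite big_ord_recl /= /distribution /pushforward.
rewrite (_ : _ @^-1` _ =
    A 0%N `*` [set t : n.-tuple U | forall i : 'I_n, A i.+1 (tnth t i)]); last first.
  apply/seteqP; split => [[u t] /= H|[u t] /= [H0 H] i].
    split; first by have := H ord0; rewrite tnth0.
    by move=> i; have := H (lift ord0 i); rewrite tnthS.
  by case: (unliftP ord0 i) => [j ->|->]; rewrite ?tnth0 ?tnthS//; exact: H.
rewrite product_measure1E//; first by congr (_ * _)%E; exact: (IH (fun i => A i.+1)).
rewrite (_ : [set _ | _] = \bigcap_(i in @setT 'I_n)
    ((fun t : n.-tuple U => tnth t i) @^-1` A i.+1)); last first.
  by apply/seteqP; split=> [t /= H i _|t /= H i]; [exact: H|exact: (H i I)].
apply: fin_bigcap_measurable => // i _.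
by rewrite -[X in measurable X]setTI; exact: measurable_tnth.
Qed.

End sequence_mean.

(** * Law of an independent family *)

Section law_of_independent_family.
Context (R : realType) (d d' : measure_display) (U : measurableType d')
  (T : measurableType d).
Variables (P : probability T R) (mu : probability U R).

(** Boxes replace cylinders on one coordinate because they are stable under intersection, as
    uniqueness of measures requires. *)
Lemma tuple_measurable_boxes n : @measurable _ (n.-tuple U) =
  <<s [set B | exists2 A : nat -> set U, (forall i, measurable (A i)) &
         B = [set t : n.-tuple U | forall i : 'I_n, A i (tnth t i)]] >>.
Proof.
apply/seteqP; split.
  apply: smallest_sub; first exact: smallest_sigma_algebra.
  case: n => [|n]; first by rewrite big_ord0.
  rewrite -bigcup_mkord_ord => _ [i /= ni [A mA <-]].
  apply: sub_sigma_algebra; exists (fun j => if j == i then A else setT).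
    by move=> j; case: ifP.
  apply/seteqP; split => t /=.
    move=> [_ At] j; case: ifPn => // /eqP ji.
    by rewrite (_ : j = inord i)//; apply/val_inj; rewrite /= inordK.
  by move=> /(_ (inord i)); rewrite inordK// eqxx.
apply: smallest_sub; first exact: sigma_algebra_measurable.
move=> _ [A mA ->].
rewrite (_ : [set _ | _] = \bigcap_(i in @setT 'I_n)
    ((fun t : n.-tuple U => tnth t i) @^-1` A i)); last first.
  by apply/seteqP; split=> [t /= H i _|t /= H i]; [exact: H|exact: (H i I)].
apply: fin_bigcap_measurable => // i _.
by rewrite -[X in measurable X]setTI; exact: measurable_tnth.
Qed.

(** Both sides are finite measures that agree on boxes, by independence applied to the whole index
    set, and boxes form a generating class stable under intersection. *)
Lemma independent_law n (X : 'I_n -> {RV P >-> U}) :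
  mutually_independent P X ->
  (forall i A, measurable A -> distribution P (X i) A = mu A) ->
  forall B : set (n.-tuple U), measurable B ->
  P [set w | B [tuple X i w | i < n]] = tuple_power mu n B.
Proof.
move=> indep law B mB.
have mX : measurable_fun setT (fun w => [tuple X i w | i < n]).
  apply/measurable_fun_tnthP => i.
  rewrite (_ : _ \o _ = X i); first exact: measurable_funPT.
  by apply/funext => w /=; rewrite tnth_mktuple.
pose X' := MeasurableFun.Pack (MeasurableFun.Class (isMeasurableFun.Build _ _ _ _ _ mX)).
change (distribution P X' B = tuple_power mu n B).
apply: (measure_unique _ (fun=> setT) (tuple_measurable_boxes n)) => //.
- move=> _ _ [A mA ->] [C mC ->]; exists (fun i => A i `&` C i).
    by move=> i; exact: measurableI.
  apply/seteqP; split => t /=; first by case=> HA HC i; split.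
  by move=> H; split=> i; case: (H i).
- by move=> _; exists (fun=> setT) => //; apply/seteqP; split.
- by rewrite bigcup_const.
- move=> _ [A mA ->]; apply: (etrans _ (esym (tuple_power_box mu n mA))).
  have := indep (finset.setTfor 'I_n) (fun i => A i) (fun i => mA i).
  rewrite /distribution /pushforward /=.
  rewrite (eq_bigl xpredT) => [|i]; last by rewrite inE.
  rewrite (eq_bigr (fun i : 'I_n => mu (A i))); last first.
    by move=> i _; exact: (law i _ (mA i)).
  move=> <-; congr (P _); apply/seteqP; split => w /=.
    by move=> H i _; have := H i; rewrite tnth_mktuple.
  by move=> H i; rewrite tnth_mktuple; apply: H; rewrite /= inE.
- by move=> _; rewrite -ge0_fin_numE// fin_num_measure.
Qed.

End law_of_independent_family.

(** * Exponential moments under bounded differences *)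

(** From exp z <= 1 / (1 - z) and exp (- z) <= 1 / (1 + z), the sum is at most 2 / (1 - z^2), and 1
    / (1 - a) <= 1 + 2 a for 0 <= a <= 1/2. *)
Lemma expR_add_expRN_le (R : realType) (z : R) : z ^+ 2 <= 2^-1 ->
  expR z + expR (- z) <= 2 + 4 * z ^+ 2.
Proof.
move=> z2.
have [z1 z1'] : 0 < 1 - z /\ 0 < 1 + z by split; nra.
have Hz : expR z <= (1 - z)^-1.
  rewrite -[expR z]invrK lef_pV2 ?posrE ?invr_gt0 ?expR_gt0// -expRN.
  exact: expR_ge1Dx.
have HNz : expR (- z) <= (1 + z)^-1.
  rewrite expRN lef_pV2 ?posrE ?expR_gt0//; exact: expR_ge1Dx.
apply: le_trans (lerD Hz HNz) _.
have -> : (1 - z)^-1 + (1 + z)^-1 = 2 / ((1 - z) * (1 + z)).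
  by field; rewrite !gt_eqF.
by rewrite ler_pdivrMr ?mulr_gt0//; nra.
Qed.

(** Between e^-1 and e, the function r + r^-1 is largest at the end points: the difference of the
    two sides is a product of two nonnegative factors. *)
Lemma add_inv_le (R : realType) (r e : R) : 0 < r -> 0 < e -> r <= e -> r^-1 <= e ->
  r + r^-1 <= e + e^-1.
Proof.
move=> r0 e0 re rVe.
have : 0 <= (e - r) * (1 - e^-1 * r^-1).
  by rewrite mulr_ge0 ?subr_ge0// mulrC ler_pdivrMr// mul1r.
rewrite (_ : _ * _ = e + e^-1 - (r + r^-1)) ?subr_ge0//.
by field; rewrite !gt_eqF.
Qed.

Section exponential_moments.
Context (R : realType) (d : measure_display) (U : measurableType d).
Variable mu : probability U R.
Implicit Types (f : seq U -> R) (q : U -> R).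

(* By induction on m: with F u and G u the means of exp f and exp (- f) given
   that the first point is u, F u * G u is bounded by induction and F u / F v
   lies in [exp (- z), exp z] where z ^ 2 <= 2 (q u + q v), so that
   F u * G v + F v * G u <= B * (exp z + exp (- z)). *)
Lemma mean_pow_exp_mul m f q : seqmeas m f -> bdmeas q -> (forall u, 0 <= q u) ->
  (forall s1 u v s2, (size s1 + size s2).+1 = m ->
    (f (s1 ++ u :: s2) - f (s1 ++ v :: s2)) ^+ 2 <= Num.min (2 * (q u + q v)) 2^-1) ->
  mean_pow mu m (fun s => expR (f s)) * mean_pow mu m (fun s => expR (- f s)) <=
  (1 + 8 * \int[mu]_u q u) ^+ m.
Proof.
move=> mf bq q0; elim: m f mf => [|m IH] f mf df.
  by rewrite !mean_pow0 expr0 expRN divff// gt_eqF// expR_gt0.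
have mef : seqmeas m.+1 (fun s => expR (f s)) by exact: bdmeas_expR.
have meNf : seqmeas m.+1 (fun s => expR (- f s)).
  by apply: bdmeas_expR; exact: bdmeasN.
rewrite !mean_powS//.
set F := fun u => mean_pow mu m (fun s => expR (f (u :: s))).
set G := fun u => mean_pow mu m (fun s => expR (- f (u :: s))).
pose B : R := (1 + 8 * \int[mu]_u q u) ^+ m.
have mFu (g : seq U -> R) u : seqmeas m.+1 g -> seqmeas m (fun s => g (u :: s)).
  exact: seqmeas_cons.
(* Boundedness of [g] keeps the mean of its exponential away from 0, so that quotients of values of
   [F] and [G] make sense. *)
have posE (g : seq U -> R) u : seqmeas m.+1 g -> 0 < mean_pow mu m (fun s => expR (g (u :: s))).
  move=> mg; have [_ [A gA]] := mFu _ u mg.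
  apply: (@lt_le_trans _ _ (expR (- A))); first exact: expR_gt0.
  rewrite -[leLHS](mean_cst (tuple_power mu m)); apply: mean_le.
  - exact: bdmeas_cst.
  - by apply: bdmeas_expR; exact: mFu.
  - by move=> t; rewrite ler_expR; have := gA t; rewrite ler_norml => /andP[].
have F0 u : 0 < F u by exact: posE.
have G0 u : 0 < G u by apply: (posE (fun s => - f s)); exact: bdmeasN.
have FG u : F u * G u <= B.
  apply: IH => [|s1 v w s2 sm]; first exact: mFu.
  by apply: (df (u :: s1)); rewrite /= addSn sm.
pose z u v : R := Num.sqrt (Num.min (2 * (q u + q v)) 2^-1).
have z2 u v : z u v ^+ 2 = Num.min (2 * (q u + q v)) 2^-1.
  by rewrite sqr_sqrtr// le_min invr_ge0 ler0n mulr_ge0 ?addr_ge0.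
have FF u v : F u <= expR (z u v) * F v.
  rewrite -meanZ; last by apply: bdmeas_expR; exact: mFu.
  apply: mean_le => [| |t].
  - by apply: bdmeas_expR; exact: mFu.
  - apply: bdmeasM; first exact: bdmeas_cst.
    by apply: bdmeas_expR; exact: mFu.
  rewrite -expRD ler_expR -lerBlDr.
  apply: le_trans (ler_norm _) _.
  rewrite -sqrtr_sqr ler_wsqrtr//.
  by apply: (df [::]); rewrite /= size_tuple.
have FGuv u v : F u * G v + F v * G u <= B * (2 + 8 * (q u + q v)).
  have r0 : 0 < F u / F v by rewrite divr_gt0.
  have : F u / F v + (F u / F v)^-1 <= expR (z u v) + expR (- z u v).
    rewrite expRN; apply: add_inv_le => //; first exact: expR_gt0.
      by rewrite ler_pdivrMr.
    by rewrite invf_div ler_pdivrMr// {1}/z [q u + _]addrC; exact: FF.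
  have zh : z u v ^+ 2 <= 2^-1 by rewrite z2 ge_min lexx orbT.
  have zq : z u v ^+ 2 <= 2 * (q u + q v) by rewrite z2 ge_min lexx.
  move=> /le_trans /(_ (expR_add_expRN_le zh)) rz.
  have {}rz : F u / F v + (F u / F v)^-1 <= 2 + 8 * (q u + q v) by lra.
  apply: (@le_trans _ _ (B * (F u / F v + (F u / F v)^-1))); last first.
    rewrite ler_wpM2l//; apply: le_trans (FG u); exact/ltW/mulr_gt0.
  rewrite invf_div mulrDr lerD//.
  - rewrite mulrCA ler_pM2l// -[leLHS](mulfK (lt0r_neq0 (F0 v))).
    by rewrite ler_pM2r ?invr_gt0// mulrC.
  - rewrite mulrCA ler_pM2l// -[leLHS](mulfK (lt0r_neq0 (F0 u))).
    by rewrite ler_pM2r ?invr_gt0// mulrC.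
have bF : bdmeas F by exact: (bdmeas_mean mu (tuple_power mu m) (seqmeas_pair mef)).
have bG : bdmeas G by exact: (bdmeas_mean mu (tuple_power mu m) (seqmeas_pair meNf)).
clearbody F G.
have inner u : \int[mu]_v (F u * G v + F v * G u) =
    F u * \int[mu]_v G v + G u * \int[mu]_v F v.
  rewrite meanD; last 2 first.
  - exact: bdmeasZ.
  - exact: bdmeasMr.
  rewrite meanZ//; congr (_ + _).
  by rewrite -meanZ//; apply: eq_Rintegral => v _; rewrite mulrC.
have innerle u : F u * \int[mu]_v G v + G u * \int[mu]_v F v <=
    B * (2 + 8 * (q u + \int[mu]_v q v)).
  rewrite -inner.
  have -> : B * (2 + 8 * (q u + \int[mu]_v q v)) =
      \int[mu]_v (B * (2 + 8 * q u) + (B * 8) * q v).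
    rewrite meanD; [|exact: bdmeas_cst|exact: bdmeasZ].
    by rewrite mean_cst meanZ//; ring.
  apply: mean_le => [| |v].
  - apply: bdmeasD; first exact: bdmeasZ.
    exact: bdmeasMr.
  - apply: bdmeasD; first exact: bdmeas_cst.
    exact: bdmeasZ.
  - by apply: le_trans (FGuv u v) _; rewrite le_eqVlt; apply/predU1P; left; ring.
set IF := \int[mu]_u F u; set IG := \int[mu]_u G u; set Q := \int[mu]_u q u.
(* Averaging the bound on F u * G v + F v * G u over u and v gives twice the wanted product on the
   left, and 2 (1 + 8 Q) on the right because [q u] and [q v] both average to [Q]. *)
suff : IF * IG + IG * IF <= B * (2 + 16 * Q).
  by rewrite exprSr -/B; nra.
have -> : IF * IG + IG * IF = \int[mu]_u (IG * F u + IF * G u).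
  rewrite meanD; last 2 first.
  - exact: bdmeasZ.
  - exact: bdmeasZ.
  by rewrite !meanZ// -/IF -/IG; ring.
have -> : B * (2 + 16 * Q) = \int[mu]_u (B * (2 + 8 * Q) + (B * 8) * q u).
  rewrite meanD; [|exact: bdmeas_cst|exact: bdmeasZ].
  by rewrite mean_cst meanZ// -/Q; ring.
apply: mean_le => [| |u].
- by apply: bdmeasD; exact: bdmeasZ.
- apply: bdmeasD; first exact: bdmeas_cst.
  exact: bdmeasZ.
- rewrite [IG * _]mulrC [IF * _]mulrC; apply: le_trans (innerle u) _.
  by rewrite le_eqVlt; apply/predU1P; left; rewrite -/Q; ring.
Qed.

End exponential_moments.

(** * Empty cells *)

Section empty_cells.
Context (R : realType) (d : measure_display) (U : measurableType d).
Variables (mu : probability U R) (I : finType) (cell : U -> I).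
Hypothesis mcell : forall c, measurable [set u | cell u = c].
Hypothesis cell_uniform : forall c, mu [set u | cell u = c] = (#|I|%:R^-1)%:E.

Definition empty_cell (s : seq U) (c : I) : bool := all (fun u => cell u != c) s.

Definition empty_count (s : seq U) : R := \sum_(c : I) (empty_cell s c)%:R.

Lemma all_prod (p : pred U) (s : seq U) :
  (all p s)%:R = \prod_(u <- s) (p u)%:R :> R.
Proof.
elim: s => [|u s IH] /=; first by rewrite big_nil.
by rewrite big_cons -IH; case: (p u); rewrite ?mul1r ?mul0r.
Qed.

Lemma measurable_cell (p : pred I) : measurable_fun setT (fun u => p (cell u)).
Proof.
apply: (@measurable_fun_bool _ _ _ _ true).
rewrite setTI (_ : _ @^-1` _ = \bigcup_(c in [set c | p c]) [set u | cell u = c]).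
  by apply: fin_bigcup_measurable.
apply/seteqP; split => u /=; first by exists (cell u).
by move=> [c /= pc ->].
Qed.

Lemma bdmeas_cell (p : pred I) : bdmeas (fun u => (p (cell u))%:R : R).
Proof. by apply: bdmeas_bool; exact: measurable_cell. Qed.

Lemma mean_cell (p : pred I) :
  \int[mu]_u (p (cell u))%:R = #|[pred c | p c]|%:R / #|I|%:R.
Proof.
have E u : (p (cell u))%:R = \sum_(c | p c) (cell u == c)%:R :> R.
  rewrite big_mkcond (bigD1 (cell u)) //= eqxx big1 => [|c nc].
    by rewrite addr0; case: (p _).
  by rewrite eq_sym (negbTE nc); case: (p c).
under eq_Rintegral do rewrite E.
rewrite mean_sum => [|c]; last exact: (bdmeas_cell (pred1 c)).
rewrite (eq_bigr (fun=> #|I|%:R^-1)) => [|c _].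
  by rewrite big_const iter_addr_0 mulr_natl.
rewrite mean_bool; last exact: (measurable_cell (pred1 c)).
rewrite (_ : [set _ | _] = [set u | cell u = c]) ?cell_uniform//.
by apply/seteqP; split => u /= /eqP.
Qed.

Lemma seqmeas_all n (p : pred I) :
  seqmeas n (fun s => (all (fun u => p (cell u)) s)%:R : R).
Proof.
rewrite /seqmeas; under eq_fun do rewrite all_prod.
by apply: seqmeas_prod; exact: bdmeas_cell.
Qed.

Lemma seqmeas_empty_count n : seqmeas n empty_count.
Proof. by apply: bdmeas_sum => c; exact: (seqmeas_all n (predC1 c)). Qed.

Lemma empty_cells_set (s : seq U) (S : {set I}) :
  \prod_(c in S) (empty_cell s c)%:R = (all (fun u => cell u \notin S) s)%:R :> R.
Proof.
have [/allP H|/allPn[u us]] := boolP (all _ s).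
  rewrite big1// => c cS; rewrite (_ : empty_cell s c)//.
  by apply/allP => u /H; apply: contraNneq => ->.
rewrite negbK => uS; rewrite (bigD1 (cell u))//= (_ : empty_cell s _ = false) ?mul0r//.
by apply/negbTE/allPn; exists u; rewrite // negbK.
Qed.

(** The indicators of empty cells are dependent, so the exponential is expanded as the product over
    c of 1 + w 1(c empty), that is, as a sum over sets S of cells of w^|S| 1(S empty). The
    probability that S is empty, (1 - |S|/|I|)^n, is at most y^|S| with y = exp (- n/|I|), and the
    sum folds back to (1 + w y)^|I| <= exp (|I| w y). *)
Lemma empty_count_exp_moment n (theta : R) : 0 <= theta ->
  mean_pow mu n (fun s => expR (theta * empty_count s)) <=
  expR (#|I|%:R * expR (theta - n%:R / #|I|%:R)).
Proof.
move=> th0; set w := expR theta - 1.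
have w0 : 0 <= w by rewrite subr_ge0 -expR0 ler_expR.
have E (s : seq U) : expR (theta * empty_count s) =
    \sum_(S : {set I}) w ^+ #|S| * (all (fun u => cell u \notin S) s)%:R.
  rewrite /empty_count mulr_sumr expR_sum.
  rewrite (eq_bigr (fun c => w * (empty_cell s c)%:R + 1)) => [|c _]; last first.
    case: empty_cell; rewrite ?mulr1 ?mulr0 ?add0r ?expR0//.
    by rewrite /w subrK.
  rewrite bigA_distr; apply: eq_bigr => S _.
  by rewrite -big_mkcond big_split/= prodr_const empty_cells_set.
have -> : mean_pow mu n (fun s => expR (theta * empty_count s)) =
    \sum_(S : {set I}) w ^+ #|S| * (1 - #|S|%:R / #|I|%:R) ^+ n.
  rewrite /mean_pow; under eq_Rintegral do rewrite E.
  rewrite mean_sum => [|S]; last by apply: bdmeasZ; exact: (seqmeas_all n (fun c => c \notin S)).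
  apply: eq_bigr => S _.
  rewrite meanZ; last exact: (seqmeas_all n (fun c => c \notin S)).
  congr (_ * _); under eq_Rintegral do rewrite all_prod.
  rewrite -/(mean_pow mu n (fun s => \prod_(u <- s) _)) mean_pow_prod; last first.
    exact: (bdmeas_cell (fun c => c \notin S)).
  congr (_ ^+ _); rewrite (mean_cell (fun c => c \notin S)).
  (* Without cells [U] would be empty, against total mass one. *)
  have I0 : (0 < #|I|)%N.
    rewrite lt0n; apply/eqP => I0.
    have : mu setT = 1%E by exact: probability_setT.
    rewrite (_ : setT = set0) ?measure0.
      by move/eqP; rewrite eqe eq_sym oner_eq0.
    by apply/seteqP; split=> // u _; have := enum_rank (cell u); rewrite I0 => -[].
  have -> : #|[pred c | c \notin S]|%:R = #|I|%:R - #|S|%:R :> R.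
    by apply/eqP; rewrite eq_sym subr_eq -natrD addnC cardC.
  by rewrite mulrBl divff// pnatr_eq0 -lt0n.
pose y : R := expR (- (n%:R / #|I|%:R)).
apply: (@le_trans _ _ (\sum_(S : {set I}) \prod_c (if c \in S then w * y else 1))).
  apply: ler_sum => S _; rewrite -big_mkcond prodr_const exprMn ler_wpM2l ?exprn_ge0//.
  have SI : 0 <= 1 - #|S|%:R / #|I|%:R :> R.
    have [I0|I0] := posnP #|I|; first by rewrite I0 invr0 mulr0 subr0.
    by rewrite subr_ge0 ler_pdivrMr ?ltr0n// mul1r ler_nat max_card.
  apply: (@le_trans _ _ (expR (- (#|S|%:R / #|I|%:R)) ^+ n)).
    by rewrite lerXn2r ?nnegrE ?expR_ge0// expR_ge1Dx.
  rewrite /y -!expRM_natl ler_expR !mulrN lerN2.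
  by rewrite le_eqVlt; apply/predU1P; left; ring.
rewrite -bigA_distr prodr_const expRM_natl.
apply: lerXn2r; rewrite ?nnegrE ?expR_ge0//.
  by rewrite addr_ge0 ?mulr_ge0 ?expR_ge0.
apply: (@le_trans _ _ (expR (w * y))).
  by rewrite /= [w * y + 1]addrC expR_ge1Dx.
rewrite ler_expR.
by rewrite expRD -/y ler_wpM2r ?expR_ge0// /w lerBlDr lerDl.
Qed.

(** Markov's inequality for the exponential moment; [theta] stays free because its choice depends on
    the level of the cells. *)
Lemma empty_count_tail n (theta b : R) : 0 <= theta ->
  mean_pow mu n (fun s => (b <= empty_count s)%R%:R) <=
  expR (#|I|%:R * expR (theta - n%:R / #|I|%:R) - theta * b).
Proof.
move=> th0; have mE := seqmeas_empty_count n.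
have mexp : seqmeas n (fun s => expR (theta * empty_count s)).
  by apply: bdmeas_expR; exact: bdmeasZ.
rewrite [leRHS]expRD [leRHS]mulrC; apply: (@le_trans _ _ (expR (- (theta * b)) *
    mean_pow mu n (fun s => expR (theta * empty_count s)))); last first.
  by rewrite ler_wpM2l ?expR_ge0// empty_count_exp_moment.
rewrite -meanZ//; apply: mean_le => [| |t].
- apply: bdmeas_bool; apply: measurable_fun_ler; first exact: measurable_cst.
  by case: mE.
- exact: bdmeasZ.
- rewrite -expRD; have [bE|_] := leP b; last exact: expR_ge0.
  by rewrite -[leLHS]expR0 ler_expR addrC subr_ge0 ler_wpM2l.
Qed.

End empty_cells.

(** * Dyadic cells *)

Section dyadic_cells.
Context (R : realType).
Implicit Types (x : R) (u : R * R) (j : nat).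

Definition clamp1 x : R := Num.max 0 (Num.min x 1).

(** A retraction of the plane onto the square. Arbitrary points can then be used as arguments while
    [L] only meets subsets of the square, and a sample in the square is unchanged. *)
Definition clamp u : R * R := (clamp1 u.1, clamp1 u.2).

Lemma clamp1_itv x : 0 <= clamp1 x <= 1.
Proof. by rewrite /clamp1 le_max lexx /= ge_max ler01 ge_min lexx orbT. Qed.

Lemma clamp1_id x : 0 <= x <= 1 -> clamp1 x = x.
Proof. by move=> /andP[x0 x1]; rewrite /clamp1 (min_l x1) (max_r x0). Qed.

Lemma unit_squareE u : unit_square R u <-> (0 <= u.1 <= 1) /\ (0 <= u.2 <= 1).
Proof. by rewrite /unit_square /= !in_itv. Qed.

Lemma clamp_square u : unit_square R (clamp u).
Proof. by apply/unit_squareE; split; exact: clamp1_itv. Qed.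

Lemma clamp_id u : unit_square R u -> clamp u = u.
Proof. by move=> /unit_squareE[u1 u2]; rewrite /clamp !clamp1_id// -surjective_pairing. Qed.

Lemma measurable_clamp1 : measurable_fun setT clamp1.
Proof.
apply: measurable_maxr; first exact: measurable_cst.
by apply: measurable_minr => //; exact: measurable_cst.
Qed.

Lemma measurable_clamp : measurable_fun setT clamp.
Proof.
by apply: measurable_fun_pair; apply: measurableT_comp => //; exact: measurable_clamp1.
Qed.

Lemma coord_subproof j x : (minn (Num.truncn (2 ^+ j * x)) (2 ^ j).-1 < 2 ^ j)%N.
Proof. by rewrite gtn_min ltn_predL expn_gt0 orbT. Qed.

(* The squares are closed, so the last index also receives the right end point
   in order to obtain a partition. *)
Definition dcoord j x : 'I_(2 ^ j) := Ordinal (coord_subproof j x).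

Definition cell_itv j (a : nat) : interval R :=
  Interval (BLeft (a%:R * 2 ^- j)) (BSide (a.+1 != 2 ^ j)%N (a.+1%:R * 2 ^- j)).

Lemma pow2_gt0 j : 0 < 2 ^+ j :> R.
Proof. by rewrite exprn_gt0. Qed.

Lemma pow2V_gt0 j : 0 < 2 ^- j :> R.
Proof. by rewrite invr_gt0 pow2_gt0. Qed.

Lemma coord_itv j x (a : 'I_(2 ^ j)) : 0 <= x <= 1 ->
  dcoord j x = a <-> x \in cell_itv j a.
Proof.
move=> /andP[x0 x1].
have jx0 : 0 <= 2 ^+ j * x by rewrite mulr_ge0// ltW// pow2_gt0.
have jx1 : 2 ^+ j * x <= (2 ^ j)%:R by rewrite natrX ler_piMr// ltW// pow2_gt0.
have E : (x \in cell_itv j a) =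
    (a%:R <= 2 ^+ j * x) && (if (a.+1 == 2 ^ j)%N then true else 2 ^+ j * x < a.+1%:R).
  rewrite in_itv /= ler_pdivrMr ?pow2_gt0// [x * _]mulrC; congr (_ && _).
  case: eqP => [aj|_] /=.
    by rewrite ler_pdivlMr ?pow2_gt0// [x * _]mulrC aj jx1.
  by rewrite ltr_pdivlMr ?pow2_gt0// [x * _]mulrC.
rewrite E -(truncn_ge_nat _ jx0) -(truncn_lt_nat _ jx0).
have aj := ltn_ord a.
have tj : (Num.truncn (2 ^+ j * x) <= 2 ^ j)%N by rewrite -(ler_nat R) (le_trans _ jx1)// truncn_le.
split=> [<- /=|].
  case: eqP; lia.
move=> /andP[at1 at2]; apply/val_inj => /=; move: at2; case: eqP; lia.
Qed.

Lemma coord_bounds j x : 0 <= x <= 1 ->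
  (dcoord j x)%:R * 2 ^- j <= x <= (dcoord j x).+1%:R * 2 ^- j.
Proof.
move=> x01; have /(coord_itv _ x01) := erefl (dcoord j x).
by rewrite in_itv /= => /andP[-> /=]; case: (_ != _) => // /ltW.
Qed.

(** This point of the grid of step 2^-k is the left end of the interval [a] of level [j], and the
    intervals contain their left ends. Hence the grid meets every cell of level at most [k]. *)
Lemma coord_grid j k (a : nat) : (j <= k)%N -> (a < 2 ^ j)%N ->
  dcoord j ((a * 2 ^ (k - j))%:R * 2 ^- k : R) = a :> nat.
Proof.
move=> jk aj.
have E : (a * 2 ^ (k - j))%:R * 2 ^- k = a%:R * 2 ^- j :> R.
  rewrite natrM natrX -mulrA; congr (_ * _).
  have -> : 2 ^+ k = 2 ^+ (k - j) * 2 ^+ j :> R by rewrite -exprD subnK.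
  by rewrite invfM mulrA divff ?mul1r// gt_eqF// pow2_gt0.
rewrite E /=.
have -> : 2 ^+ j * (a%:R * 2 ^- j) = a%:R :> R.
  by rewrite mulrC mulfVK// gt_eqF// pow2_gt0.
rewrite natrK; apply/minn_idPl; lia.
Qed.

Lemma measure_cell_itv j a : (a < 2 ^ j)%N ->
  @lebesgue_measure R [set` cell_itv j a] = (2 ^- j)%:E.
Proof.
move=> aj; rewrite lebesgue_measure_itv /= lte_fin ltr_pM2r ?pow2V_gt0// ltr_nat leqnn.
by rewrite -EFinB -mulrBl -natrB// subSnn mul1r.
Qed.

Lemma cell_itv01 j a x : (a < 2 ^ j)%N -> x \in cell_itv j a -> 0 <= x <= 1.
Proof.
move=> aj; rewrite in_itv /= => /andP[ax xa]; apply/andP; split.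
  by apply: le_trans ax; rewrite mulr_ge0// ltW// pow2V_gt0.
have {}xa : x <= a.+1%:R * 2 ^- j by move: xa; case: (_ != _) => // /ltW.
by apply: le_trans xa _; rewrite ler_pdivrMr ?pow2_gt0// mul1r -natrX ler_nat.
Qed.

Definition cell j u : 'I_(2 ^ j) * 'I_(2 ^ j) :=
  (dcoord j (clamp1 u.1), dcoord j (clamp1 u.2)).

Lemma card_cells j : #|{: 'I_(2 ^ j) * 'I_(2 ^ j)}| = (2 ^ j * 2 ^ j)%N.
Proof. by rewrite card_prod !card_ord. Qed.

Lemma measurable_cell_eq j c : measurable [set u | cell j u = c].
Proof.
rewrite (_ : [set _ | _] = (clamp1 @^-1` [set` cell_itv j c.1]) `*`
                           (clamp1 @^-1` [set` cell_itv j c.2])).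
  by apply: measurableX; rewrite -[X in measurable X]setTI;
    apply: measurable_clamp1 => //; exact: measurable_itv.
apply/seteqP; split => u /=.
  by move=> <-; split; apply/coord_itv => //; exact: clamp1_itv.
move=> [/coord_itv H1 /coord_itv H2]; rewrite /cell H1 ?H2 ?clamp1_itv//.
by rewrite -surjective_pairing.
Qed.

Lemma square_measure_cell j c :
  ((@lebesgue_measure R \x @lebesgue_measure R)
    ([set u | cell j u = c] `&` unit_square R) =
   (#|{: 'I_(2 ^ j) * 'I_(2 ^ j)}|%:R^-1)%:E)%E.
Proof.
rewrite (_ : _ `&` _ = [set` cell_itv j c.1] `*` [set` cell_itv j c.2]).
  rewrite product_measure1E//; try exact: measurable_itv.
  transitivity ((2 ^- j)%:E * (2 ^- j)%:E : \bar R)%E.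
    by congr (_ * _)%E; exact: measure_cell_itv.
  by rewrite -EFinM card_cells natrM natrX invfM.
apply/seteqP; split => u /=.
  move=> [<- /unit_squareE[u1 u2]]; rewrite /cell/= !clamp1_id//.
  by split; [exact: (coord_itv (dcoord j u.1) u1).1|exact: (coord_itv (dcoord j u.2) u2).1].
move=> [H1 H2].
have u1 := cell_itv01 (ltn_ord c.1) H1; have u2 := cell_itv01 (ltn_ord c.2) H2.
split; last by apply/unit_squareE.
rewrite /cell !clamp1_id// (coord_itv c.1 u1).2// (coord_itv c.2 u2).2//.
by rewrite -surjective_pairing.
Qed.

End dyadic_cells.

(** * Regular functionals *)

Section regular_functionals.
Context (R : realType) (kappa : R) (L : {fset R * R} -> R).
Hypothesis regL : dyadic_regular kappa L.
Hypothesis kappa0 : 0 < kappa.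
Implicit Types (s : seq (R * R)) (u v : R * R) (j k : nat).

(* The condition of regularity involves squares within 16 sides of C, and
   passing to indices costs at most two more units; 20 leaves some room. *)
Definition close_index (a b : nat) : bool := ((a <= b + 20) && (b <= a + 20))%N.

Definition unsafe j s u : bool :=
  [exists c : 'I_(2 ^ j) * 'I_(2 ^ j),
    [&& close_index c.1 (cell j u).1, close_index c.2 (cell j u).2 & empty_cell (cell j) s c]].

Definition points s : {fset R * R} := seq_fset tt (map (@clamp R) s).

Lemma in_points s u : (u \in points s) = (u \in map (@clamp R) s).
Proof. exact: seq_fsetE. Qed.

Lemma points_square s : [set` points s] `<=` unit_square R.
Proof. by move=> u /=; rewrite in_points => /mapP[v _ ->]; exact: clamp_square. Qed.

Lemma eq_points s s' : s =i s' -> points s = points s'.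
Proof. by move=> ss'; apply/fsetP => u; rewrite !in_points; exact: eq_mem_map. Qed.

Lemma points_cat s s' : points (s ++ s') = (points s `|` points s')%fset.
Proof. by apply/fsetP => u; rewrite in_fsetU !in_points map_cat mem_cat. Qed.

Lemma card_points s : (#|` points s| <= size s)%N.
Proof. by rewrite size_seq_fset (leq_trans (size_undup _))// size_map. Qed.

Lemma set_dist_lt (A B : set (R * R)) (e : R) : A !=set0 -> B !=set0 ->
  set_dist A B < e -> exists p q, [/\ A p, B q & euclidean_dist p q < e].
Proof.
move=> [a Aa] [b Bb] /inf_lt[|_ [p Ap [q Bq <-]] pqe]; last by exists p, q.
by exists (euclidean_dist a b), a => //; exists b.
Qed.

Lemma euclidean_dist1 (p q : R * R) : `|p.1 - q.1| <= euclidean_dist p q.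
Proof. by rewrite -sqrtr_sqr ler_wsqrtr// lerDl sqr_ge0. Qed.

Lemma euclidean_dist2 (p q : R * R) : `|p.2 - q.2| <= euclidean_dist p q.
Proof. by rewrite -sqrtr_sqr ler_wsqrtr// lerDr sqr_ge0. Qed.

Lemma close_index_dist j (i : nat) (w p q : R) : 0 <= w <= 1 ->
  i%:R * 2 ^- j <= p <= i.+1%:R * 2 ^- j ->
  (dcoord j.+1 w)%:R * 2 ^- j.+1 <= q <= (dcoord j.+1 w).+1%:R * 2 ^- j.+1 ->
  `|p - q| < 17 * 2 ^- j -> close_index i (dcoord j w).
Proof.
move=> w01 /andP[ip pi] /andP[bq qb]; rewrite ltr_norml => /andP[pq qp].
have /andP[aw wa] := coord_bounds j w01.
have /andP[bw wb] := coord_bounds j.+1 w01.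
set b := dcoord j.+1 w in bq qb bw wb; set a := dcoord j w in aw wa *.
have h0 := pow2V_gt0 R j.+1.
have hh : 2 ^- j = 2 * 2 ^- j.+1 :> R.
  by rewrite exprS invfM mulrA divff ?mul1r.
rewrite hh in ip pi pq qp aw wa; set h := 2 ^- j.+1 in h0 ip pi bq qb pq qp aw wa bw wb.
rewrite -[b.+1]addn1 -[a.+1]addn1 -[i.+1]addn1 !natrD in pi qb wa wb.
(* In units of h = 2^-(j+1), [p] and [q] differ by less than 34, while [q] and [w] share an interval
   of length 1, whence 35. The indices then differ by less than 18.5. *)
have key (x y : nat) : x%:R * (2 * h) < (y%:R + 1) * (2 * h) + 35 * h -> (x <= y + 20)%N.
  move=> xy; rewrite leqNgt; apply/negP => yx.
  have : (y + 20 + 1)%:R <= x%:R :> R by rewrite ler_nat addn1.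
  rewrite !natrD => /(ler_wpM2r (ltW h0)); move: xy; lra.
by apply/andP; split; apply: key; lra.
Qed.

(** Regularity at level [j.+1] with a single added point: the squares it asks about have level [j]
    and are close to the cell of [u], so each of them contains a point of [s]. Only the known part
    [s] of the configuration [F] matters, so that [F] may contain arbitrary further points. *)
Lemma add_point_le j s u (F : {fset R * R}) : ~~ unsafe j s u ->
  [set` F] `<=` unit_square R -> {in s, forall v, clamp v \in F} ->
  `|L (F `|` [fset clamp u])%fset - L F| <= kappa * 2 ^- j.+1.
Proof.
move=> safe Fsq sF.
pose C := dyadic_square R j.+1 (cell j.+1 u).1 (cell j.+1 u).2.
have Cu : C (clamp u).
  by split; rewrite /= in_itv /=; apply: coord_bounds; exact: clamp1_itv.
have -> : kappa * 2 ^- j.+1 =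
    kappa * 2 ^ (- j.+1%:Z) * Num.sqrt (#|` [fset clamp u]%fset|)%:R.
  by rewrite cardfs1 sqrtr1 mulr1 exprnN.
apply: (regL (C := C)) => //.
- by exists (cell j.+1 u).1, (cell j.+1 u).2.
- move=> C' [i [i' [ij i'j ->]]] dC.
  have inC' (c1 c2 : nat) :
      (dyadic_square R j c1 c2) (c1%:R * 2 ^- j, c2%:R * 2 ^- j).
    by split; rewrite /= in_itv /= lexx ler_pM2r ?pow2V_gt0// ler_nat /=.
  (* The radius 2^(-(j+1)+5) is 16 sides of level [j]. Relaxing 16 to 17 makes the inequality
     strict, so that the infimum yields two actual points. *)
  have dlt : set_dist (dyadic_square R j i i') C < 17 * 2 ^- j.
    apply: le_lt_trans dC _; rewrite expfzDr// -exprnN exprS invfM -exprnP.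
    by rewrite mulrAC ltr_pM2r ?pow2V_gt0//; lra.
  have [p [q [[p1 p2] [q1 q2] pq]]] : exists p q,
      [/\ (dyadic_square R j i i') p, C q & euclidean_dist p q < 17 * 2 ^- j].
    by apply: set_dist_lt => //; [exists (i%:R * 2 ^- j, i'%:R * 2 ^- j)|exists (clamp u)].
  move: p1 p2 q1 q2; rewrite /= !in_itv /= => p1 p2 q1 q2.
  have n1 := close_index_dist (clamp1_itv u.1) p1 q1 (le_lt_trans (euclidean_dist1 _ _) pq).
  have n2 := close_index_dist (clamp1_itv u.2) p2 q2 (le_lt_trans (euclidean_dist2 _ _) pq).
  move: safe; rewrite negb_exists => /forallP /(_ (Ordinal ij, Ordinal i'j)).
  rewrite /= n1 n2 /= => /allPn[v vs]; rewrite negbK => /eqP [vi vi'].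
  exists (clamp v); split; last exact: sF.
  have := coord_bounds j (clamp1_itv v.1); have := coord_bounds j (clamp1_itv v.2).
  by rewrite /= vi vi' => v2 v1; split; rewrite /= in_itv.
- by move=> v /=; rewrite inE => /eqP ->.
Qed.

(** At level 1 the only square that must meet [F] is the whole unit square. The set [G] is added
    quarter by quarter, and each of the four quarters costs at most kappa / 2 times the root of the
    size of [G]. *)
Lemma add_points_le (F G : {fset R * R}) : F != fset0 ->
  [set` F] `<=` unit_square R -> [set` G] `<=` unit_square R ->
  `|L (F `|` G)%fset - L F| <= 2 * kappa * Num.sqrt (#|` G|)%:R.
Proof.
move=> /fset0Pn[v vF] Fsq Gsq.
set r := Num.sqrt _.
pose H (l : seq ('I_2 * 'I_2)) := [fset x in G | cell 1 x \in l]%fset.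
suff main l : `|L (F `|` H l)%fset - L F| <= (size l)%:R * (kappa * 2^-1 * r).
  have := main (enum {: 'I_2 * 'I_2}).
  rewrite (_ : H _ = G); last first.
    by apply/fsetP => x; rewrite !inE /= mem_enum andbT.
  rewrite -cardE card_prod !card_ord => /le_trans; apply.
  by rewrite le_eqVlt; apply/predU1P; left; lra.
elim: l => [|c l IH].
  rewrite (_ : H [::] = fset0) ?fsetU0 ?subrr ?normr0 ?mul0r//.
  by apply/fsetP => x; rewrite !inE andbF.
pose Hc := [fset x in G | cell 1 x == c]%fset.
have -> : (F `|` H (c :: l) = (F `|` H l) `|` Hc)%fset.
  by apply/fsetP => x; rewrite !inE andb_orr [X in _ || X]orbC orbA.
rewrite -[X in `|X|](subrKA (L (F `|` H l)%fset)).
apply: le_trans (ler_normD _ _) _.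
rewrite [(size _)%:R]/= -addn1 natrD mulrDl mul1r addrC; apply: lerD => //.
have Hr : Num.sqrt (#|` Hc|)%:R <= r.
  by rewrite ler_wsqrtr// ler_nat fsubset_leq_card//; apply/fsubsetP => x; rewrite !inE => /andP[].
apply: (@le_trans _ _ (kappa * 2^-1 * Num.sqrt (#|` Hc|)%:R)); last first.
  by rewrite ler_wpM2l// mulr_ge0// ltW.
rewrite -[(2 : R)^-1]/((2 : R) ^ (- 1%:Z)).
apply: (regL (C := dyadic_square R 1 c.1 c.2)) => //.
- by exists c.1, c.2; split => //; exact: ltn_ord.
- by move=> x /=; rewrite !inE => /orP[/Fsq//|/andP[/Gsq]].
- move=> C' [i [i' [/=]]]; rewrite !ltnS !leqn0 => /eqP -> /eqP -> -> _.
  exists v; split; last by rewrite /= inE vF.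
  by have := Fsq v vF; rewrite /dyadic_square /unit_square !expr0 !invr1 !mul0r !mulr1.
- move=> x /=; rewrite !inE => /andP[xG /eqP xc].
  have := coord_bounds 1 (clamp1_itv x.1); have := coord_bounds 1 (clamp1_itv x.2).
  move: xc; rewrite /cell => <- /=.
  have /unit_squareE[x1 x2] := Gsq _ xG.
  by rewrite !clamp1_id// => H2 H1; split; rewrite /= in_itv.
Qed.

Definition grid k : seq (R * R) :=
  [seq (a%:R * 2 ^- k, b%:R * 2 ^- k) | a <- iota 0 (2 ^ k), b <- iota 0 (2 ^ k)].

Lemma size_grid k : size (grid k) = (2 ^ k * 2 ^ k)%N.
Proof. by rewrite size_allpairs !size_iota. Qed.

Lemma grid_coord j k (a : nat) : (j <= k)%N -> (a < 2 ^ j)%N ->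
  let b := (a * 2 ^ (k - j))%N in
  (b < 2 ^ k)%N /\ dcoord j (clamp1 (b%:R * 2 ^- k : R)) = a :> nat.
Proof.
move=> jk aj b.
have bk : (b < 2 ^ k)%N.
  have -> : (2 ^ k = 2 ^ j * 2 ^ (k - j))%N by rewrite -expnD subnKC.
  by rewrite ltn_pmul2r// expn_gt0.
split=> //; rewrite clamp1_id ?coord_grid//.
apply/andP; split; first by rewrite mulr_ge0// ltW// pow2V_gt0.
by rewrite ler_pdivrMr ?pow2_gt0// mul1r -natrX ler_nat ltnW.
Qed.

Lemma grid_not_unsafe j k s u : (j <= k)%N -> ~~ unsafe j (s ++ grid k) u.
Proof.
move=> jk; rewrite negb_exists; apply/forallP => c; rewrite !negb_and; apply/orP; right.
apply/orP; right.
have [b1 e1] := grid_coord jk (ltn_ord c.1); have [b2 e2] := grid_coord jk (ltn_ord c.2).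
apply/allPn; exists ((c.1 * 2 ^ (k - j))%:R * 2 ^- k, (c.2 * 2 ^ (k - j))%:R * 2 ^- k).
  rewrite mem_cat; apply/orP; right; apply/allpairsP.
  by exists (c.1 * 2 ^ (k - j), c.2 * 2 ^ (k - j))%N; rewrite /= !mem_iota.
rewrite negbK; apply/eqP; rewrite /cell; apply: (etrans _ (esym (surjective_pairing c))).
by congr pair; apply/val_inj; [exact: e1|exact: e2].
Qed.

Lemma unsafe_catl j s t u : unsafe j (s ++ t) u -> unsafe j s u.
Proof.
move=> /existsP[c /and3P[n1 n2]]; rewrite /empty_cell all_cat => /andP[e _].
by apply/existsP; exists c; rewrite n1 n2.
Qed.

End regular_functionals.

(** * The functional augmented by a grid *)

Section augmented_functional.
Context (R : realType) (kappa : R) (L : {fset R * R} -> R).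
Implicit Types (s t x : seq (R * R)) (u v : R * R) (j k : nat).

Lemma measurable_unit_square : measurable (unit_square R).
Proof. by apply: measurableX; exact: measurable_itv. Qed.

(** The hypothesis is applied to tuples of [n + size t] points of the square: clamped variables
    followed by constant coordinates. *)
Lemma measurable_points n t : measurable_functional L ->
  measurable_fun setT (fun s : n.-tuple (R * R) => L (points (s ++ t))).
Proof.
move=> mL.
pose g (s : n.-tuple (R * R)) : (n + size t).-tuple (R * R) :=
  [tuple of map (@clamp R) s ++ map (@clamp R) (in_tuple t)].
have gE (s : n.-tuple (R * R)) : L (points (s ++ t)) = L (point_set (tnth (g s))).
  congr L; apply/fsetP => u; rewrite in_points map_cat.
  apply/(tnthP (g s))/imfsetP => -[i]; first by move=> ->; exists i.
  by move=> _ ->; exists i.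
rewrite (_ : (fun _ => _) = (fun z => L (point_set (tnth z))) \o g); last first.
  by apply/funext => s; rewrite gE.
apply: (measurable_comp _ _ (mL _)).
- rewrite (_ : [set _ | _] = \bigcap_(i in @setT 'I_(n + size t))
    ((fun z => tnth z i) @^-1` unit_square R)).
    apply: fin_bigcap_measurable => // i _; rewrite -[X in measurable X]setTI.
    by apply: measurable_tnth => //; exact: measurable_unit_square.
  by apply/seteqP; split=> [z /= H i _|z /= H i]; [exact: H|exact: (H i I)].
- move=> _ [s _ <-] i; have := mem_tnth i (g s).
  by rewrite /= mem_cat => /orP[] /mapP[u _ ->]; exact: clamp_square.
- apply/measurable_fun_tnthP => i; case: (split_ordP i) => j ->.
    rewrite (_ : _ \o _ = @clamp R \o (fun s : n.-tuple (R * R) => tnth s j)).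
      by apply: measurableT_comp; [exact: measurable_clamp|exact: measurable_tnth].
    by apply/funext => s /=; rewrite tnth_lshift tnth_map.
  rewrite (_ : _ \o _ = cst (tnth [tuple of map (@clamp R) (in_tuple t)] j)).
    exact: measurable_cst.
  by apply/funext => s /=; rewrite tnth_rshift.
Qed.

Definition augmented k s : R := L (points (s ++ grid R k)).

(* Up to the factor kappa ^+ 2, an upper bound for the square of the effect of
   adding u once the points of x and the grid are present. *)
Definition weight (P k : nat) x u : R :=
  ((2 ^+ P) ^+ 2)^-1 + \sum_(k.+1 <= j < P.+1) ((2 ^+ j) ^+ 2)^-1 * (unsafe j x u)%:R.

Lemma weight_ge0 P k x u : 0 <= weight P k x u.
Proof.
by rewrite addr_ge0 ?invr_ge0 ?exprn_ge0// sumr_ge0.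
Qed.

Lemma bdmeas_unsafe j x : bdmeas (fun u : R * R => (unsafe j x u)%:R : R).
Proof.
pose p (b : 'I_(2 ^ j) * 'I_(2 ^ j)) := [exists c : 'I_(2 ^ j) * 'I_(2 ^ j),
  [&& close_index c.1 b.1, close_index c.2 b.2 & empty_cell (cell j) x c]].
change (bdmeas (fun u : R * R => (p (cell j u))%:R : R)).
by apply: bdmeas_cell; exact: measurable_cell_eq.
Qed.

Lemma bdmeas_weight P k x : bdmeas (weight P k x).
Proof.
apply: bdmeasD; first exact: bdmeas_cst.
by apply: bdmeas_sum => j; apply: bdmeasZ; exact: bdmeas_unsafe.
Qed.

Hypothesis regL : dyadic_regular kappa L.
Hypothesis kappa0 : 0 < kappa.

Lemma augmented_near k s : s != [::] ->
  `|augmented k s - L (points s)| <= 2 * kappa * 2 ^+ k.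
Proof.
case: s => // u s _; rewrite /augmented points_cat.
have p0 : points (u :: s) != fset0.
  by apply/fset0Pn; exists (clamp u); rewrite in_points /= mem_head.
apply: le_trans (add_points_le regL kappa0 p0 (@points_square _ _) (@points_square _ _)) _.
rewrite ler_pM2l ?mulr_gt0//.
have k0 : 0 <= 2 ^+ k :> R by rewrite exprn_ge0.
rewrite -[leRHS](ger0_norm k0) -sqrtr_sqr ler_wsqrtr//.
by apply: le_trans (_ : (2 ^ k * 2 ^ k)%:R <= _); [rewrite ler_nat -(size_grid R) card_points|rewrite natrM natrX].
Qed.

(** Boundedness comes from regarding the [n] points as added to the grid, a fixed nonempty
    configuration: the value stays within 2 kappa sqrt n of its value at the grid. *)
Lemma seqmeas_augmented n k : measurable_functional L -> seqmeas n (augmented k).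
Proof.
move=> mL; split; first exact: measurable_points.
exists (`|L (points (grid R k))| + 2 * kappa * Num.sqrt n%:R) => s.
rewrite -[augmented k s](subrK (L (points (grid R k)))) addrC.
apply: le_trans (ler_normD _ _) _; rewrite lerD2l /augmented points_cat fsetUC.
have p0 : points (grid R k) != fset0.
  have : (0 < size (grid R k))%N by rewrite size_grid muln_gt0 expn_gt0.
  case: (grid R k) => // u g _.
  by apply/fset0Pn; exists (clamp u); rewrite in_points /= mem_head.
apply: le_trans (add_points_le regL kappa0 p0 (@points_square _ _) (@points_square _ _)) _.
rewrite ler_pM2l ?mulr_gt0// ler_wsqrtr// ler_nat.
by rewrite (leq_trans (card_points _))// size_tuple.
Qed.

(** Let j be the least level in (k, P] at which [x] is unsafe for [u]. Level j - 1 is safe, by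
    minimality or thanks to the grid if j - 1 = k, so the cost is at most kappa 2^-j, and the term
    of index j of the weight pays for its square. If there is no such j, level P is safe and the
    first term suffices. The second bound comes from level k, where the grid is always safe. *)
Lemma add_point_weight P k x u (F : {fset R * R}) : (k <= P)%N ->
  [set` F] `<=` unit_square R -> {in x ++ grid R k, forall v, clamp v \in F} ->
  `|L (F `|` [fset clamp u])%fset - L F| ^+ 2 <= kappa ^+ 2 * weight P k x u /\
  `|L (F `|` [fset clamp u])%fset - L F| <= kappa * 2 ^- k.+1.
Proof.
move=> kP Fsq Fx; set D := `|_|.
have safeD j : ~~ unsafe j (x ++ grid R k) u -> D <= kappa * 2 ^- j.+1.
  move=> sj; exact: (add_point_le regL sj Fsq Fx).
have D0 : 0 <= D by exact: normr_ge0.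
split; last exact/safeD/grid_not_unsafe.
pose p j := [&& (k < j)%N, (j <= P)%N & unsafe j x u].
have sqD j : D <= kappa * 2 ^- j -> D ^+ 2 <= kappa ^+ 2 * ((2 ^+ j) ^+ 2)^-1.
  by move=> Dj; rewrite -exprVn -exprMn lerXn2r ?nnegrE// mulr_ge0 ?ltW// pow2V_gt0.
have [exj|nex] := pselect (exists j, p j); last first.
  apply: (@le_trans _ _ (kappa ^+ 2 * ((2 ^+ P) ^+ 2)^-1)).
    apply: sqD; apply: (@le_trans _ _ (kappa * 2 ^- P.+1)).
      apply: safeD; move: kP; rewrite leq_eqVlt => /predU1P[->|kP].
        exact: grid_not_unsafe.
      apply/negP => /unsafe_catl uP; apply: nex; exists P.
      by rewrite /p kP leqnn.
    by rewrite ler_pM2l// lef_pV2 ?posrE ?pow2_gt0// ler_eXn2l// ltr1n.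
  by rewrite ler_pM2l ?exprn_gt0// lerDl sumr_ge0// => j _; rewrite mulr_ge0 ?invr_ge0 ?exprn_ge0.
case: (ex_minnP exj) => j /and3P[kj jP uj] jmin.
apply: (@le_trans _ _ (kappa ^+ 2 * ((2 ^+ j) ^+ 2)^-1)).
  apply: sqD; rewrite -(prednK (leq_ltn_trans (leq0n k) kj)); apply: safeD.
  have [kj1|] := ltnP k j.-1; last by move=> ?; apply: grid_not_unsafe.
  apply/negP => /unsafe_catl uj1; have /jmin : p j.-1.
    by rewrite /p kj1 uj1 andbT (leq_trans (leq_pred j)).
  lia.
rewrite ler_pM2l ?exprn_gt0// /weight (bigD1_seq j) ?mem_index_iota ?iota_uniq ?kj//=.
rewrite uj mulr1 addrCA lerDl addr_ge0 ?invr_ge0 ?exprn_ge0// sumr_ge0//.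
Qed.

(** Both configurations add one point to a common [F]. With a and b the two increments, (a - b)^2 <=
    2 (a^2 + b^2) gives the weights, and |a - b| <= 2 kappa 2^-(k+1) gives the other bound. *)
Lemma augmented_diff P k x s1 u v s2 : (k <= P)%N ->
  (augmented k (x ++ s1 ++ u :: s2) - augmented k (x ++ s1 ++ v :: s2)) ^+ 2 <=
  kappa ^+ 2 * Num.min (2 * (weight P k x u + weight P k x v)) ((2 ^+ k) ^+ 2)^-1.
Proof.
move=> kP; pose F := points ((x ++ grid R k) ++ s1 ++ s2).
have FE w : augmented k (x ++ s1 ++ w :: s2) = L (F `|` [fset clamp w])%fset.
  congr L; apply/fsetP => z; rewrite in_fsetU !in_points in_fset1.
  rewrite !map_cat !mem_cat /= in_cons.
  by do !case: (_ \in _); rewrite ?orbT ?orbF //; case: (_ == _).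
have Fx : {in x ++ grid R k, forall w, clamp w \in F}.
  by move=> w wx; rewrite in_points map_f// mem_cat wx.
have [u1 u2] := add_point_weight u kP (@points_square _ _) Fx.
have [v1 v2] := add_point_weight v kP (@points_square _ _) Fx.
rewrite !FE; move: u1 u2 v1 v2; set a := L _ - L F; set b := L (F `|` [fset clamp v])%fset - L F.
have -> : L (F `|` [fset clamp u])%fset - L (F `|` [fset clamp v])%fset = a - b.
  by rewrite /a /b opprB addrA subrK.
rewrite !real_normK ?num_real// => u1 u2 v1 v2.
have -> : ((2 ^+ k) ^+ 2)^-1 = (2 * 2 ^- k.+1) ^+ 2 :> R.
  rewrite -exprVn; congr (_ ^+ 2).
  by rewrite (exprS 2 k) [in RHS]invfM mulrA divff ?mul1r.
rewrite minr_pMr ?exprn_ge0 ?(ltW kappa0)// le_min; apply/andP; split.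
  by have := sqr_ge0 (a + b); nra.
rewrite -exprMn -[leLHS]real_normK ?num_real// lerXn2r ?nnegrE//.
  by rewrite mulr_ge0 ?mulr_ge0 ?ltW// pow2V_gt0.
by apply: le_trans (ler_normB _ _) _; lra.
Qed.

End augmented_functional.

(** * Typical configurations *)

Lemma card_close_index n (b : nat) : (#|[pred a : 'I_n | close_index a b]| <= 41)%N.
Proof.
rewrite cardE -(size_map val) -(size_iota (b - 20) 41).
apply: uniq_leq_size; first by rewrite map_inj_uniq ?enum_uniq//; exact: val_inj.
move=> z /mapP[a]; rewrite mem_enum inE /close_index mem_iota => ? ->.
by rewrite /=; lia.
Qed.

Lemma sum_pow4_le (R : realType) k P :
  \sum_(k.+1 <= j < P.+1) (2 ^+ j) ^+ 2 <= 2 * (2 ^+ P) ^+ 2 :> R.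
Proof.
elim: P => [|P IH]; first by rewrite big_geq// mulr_ge0 ?exprn_ge0.
have [kP|kP] := leqP k P; last by rewrite big_geq ?mulr_ge0 ?exprn_ge0// ltnW.
rewrite big_nat_recr//= (exprS 2 P); have := exprn_ge0 2 (exprn_ge0 P (ler0n R 2)).
by move: IH; set x := 2 ^+ P; nra.
Qed.

Lemma sum_pow2V_le (R : realType) k P :
  \sum_(k.+1 <= j < P.+1) 2 ^+ k / 2 ^+ j <= 1 :> R.
Proof.
have [kP|kP] := leqP k P; last by rewrite big_geq// ltnW.
suff : \sum_(k.+1 <= j < P.+1) 2 ^+ k / 2 ^+ j <= 1 - 2 ^+ k / 2 ^+ P :> R.
  by move=> /le_trans; apply; rewrite gerBl divr_ge0 ?exprn_ge0.
elim: P kP => [|P IH].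
  by rewrite leqn0 => /eqP ->; rewrite big_geq// expr0 divr1 subrr.
rewrite leq_eqVlt => /predU1P[->|kP].
  by rewrite big_geq// divff ?subrr// gt_eqF// exprn_gt0.
rewrite big_nat_recr//=; apply: le_trans (lerD (IH kP) (lexx _)) _.
rewrite (exprS 2 P) [in X in _ + X]invfM [in X in _ <= 1 - X]invfM.
by set x := 2 ^+ k; set y := (2 ^+ P)^-1; lra.
Qed.

Section typical_configurations.
Context (R : realType) (mu : probability (R * R)%type R).
Hypothesis mu_uniform : forall A : set (R * R), measurable A ->
  mu A = ((@lebesgue_measure R \x @lebesgue_measure R) (A `&` unit_square R))%E.
Implicit Types (x : seq (R * R)) (j k n m P : nat).

Let mu_cell j c :
  mu [set u | cell j u = c] = (#|{: 'I_(2 ^ j) * 'I_(2 ^ j)}|%:R^-1)%:E.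
Proof.
by rewrite mu_uniform ?square_measure_cell//; exact: measurable_cell_eq.
Qed.

Definition empty_squares j x : R := empty_count R (cell j) x.

(** Union bound: an empty cell makes at most 41 * 41 cells unsafe, where 41 = 2 * 20 + 1, and each
    cell has mass 4^-j. *)
Lemma mean_unsafe j x :
  \int[mu]_u (unsafe j x u)%:R <=
  (41 * 41)%:R * ((2 ^+ j) ^+ 2)^-1 * empty_squares j x.
Proof.
pose nb (c b : 'I_(2 ^ j) * 'I_(2 ^ j)) := close_index c.1 b.1 && close_index c.2 b.2.
have bnb c : bdmeas (fun u : R * R => (nb c (cell j u))%:R : R).
  exact: (bdmeas_cell R (@measurable_cell_eq R j) (nb c)).
apply: (@le_trans _ _ (\int[mu]_u
    (\sum_c (empty_cell (cell j) x c)%:R * (nb c (cell j u))%:R))).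
  apply: mean_le => [| |u].
  - exact: bdmeas_unsafe.
  - by apply: bdmeas_sum => c; exact: bdmeasZ.
  - have [/existsP[c /and3P[c1 c2 ec]]|_] := boolP (unsafe j x u).
      rewrite (bigD1 c)//= ec /nb c1 c2 mul1r lerDl sumr_ge0//.
    by rewrite sumr_ge0.
rewrite mean_sum => [|c]; last exact: bdmeasZ.
rewrite mulr_sumr; apply: ler_sum => c _; rewrite meanZ// mulrC ler_wpM2r//.
rewrite (mean_cell (@measurable_cell_eq R j) (@mu_cell j) (nb c)).
rewrite card_cells natrM natrX -expr2 ler_wpM2r ?invr_ge0 ?exprn_ge0// ler_nat.
rewrite (eq_card (B := predX [pred a : 'I_(2 ^ j) | close_index a c.1]
                             [pred a : 'I_(2 ^ j) | close_index a c.2])).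
  by rewrite cardX leq_mul// card_close_index.
by move=> b; rewrite !inE /nb /close_index andbC [X in X && _]andbC [X in _ && X]andbC andbC.
Qed.

(* Typically a proportion at most e ^ (- theta) <= 1 / theta of the cells of
   level j is empty, with theta = 4 ^ (P - j) / 16; the second term is the
   fluctuation allowed with probability e ^ (- 4 ^ k). *)
Definition empty_bound P k j : R :=
  ((2 ^+ j) ^+ 2) ^+ 2 / (2 ^+ P) ^+ 2 *
  (16 * (16 * ((2 ^+ j) ^+ 2 / (2 ^+ P) ^+ 2) + 2 * (2 ^+ k / 2 ^+ j))).

Definition typical P k x : bool :=
  all (fun j => empty_squares j x < empty_bound P k j) (index_iota k.+1 P.+1).

Lemma measurable_typical n P k :
  measurable_fun setT (fun x : n.-tuple (R * R) => typical P k x).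
Proof.
rewrite /typical; elim: (index_iota _ _) => [|j l IH] /=; first exact: measurable_cst.
apply: measurable_and => //; apply: measurable_fun_ltr; last exact: measurable_cst.
by case: (seqmeas_empty_count R (@measurable_cell_eq R j) n).
Qed.

(** The leading 1 bounds m 4^-P. The other part sums the two terms of [empty_bound] over the levels,
    with the sum of 4^j at most 2 * 4^P and the sum of 2^(k-j) at most 1. *)
Definition weight_bound : R := 1 + (41 * 41)%:R * (16 * (16 * 2 + 2)).

Lemma typical_mean_weight P k m x : (m <= (2 ^ P) ^ 2)%N ->
  typical P k x -> m%:R * \int[mu]_u weight P k x u <= weight_bound.
Proof.
move=> mP /allP tx.
have mP' : m%:R <= (2 ^+ P) ^+ 2 :> R by rewrite -!natrX ler_nat.
have P0 : 0 < (2 ^+ P) ^+ 2 :> R by rewrite !exprn_gt0.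
rewrite meanD; last 2 first.
- exact: bdmeas_cst.
- by apply: bdmeas_sum => j; apply: bdmeasZ; exact: bdmeas_unsafe.
rewrite mean_cst mulrDr; apply: lerD.
  by rewrite ler_pdivrMr// mul1r.
rewrite mean_sum => [|j]; last by apply: bdmeasZ; exact: bdmeas_unsafe.
(* The prefactor 16^j / 4^P of [empty_bound] cancels the bound 4^P on [m], the factor 4^-j of the
   weight and the mass 4^-j of a cell. *)
rewrite mulr_sumr; apply: (@le_trans _ _ (\sum_(k.+1 <= j < P.+1)
   ((41 * 41)%:R * (16 * (16 * ((2 ^+ P) ^+ 2)^-1)) * (2 ^+ j) ^+ 2 +
    (41 * 41)%:R * (16 * 2) * (2 ^+ k / 2 ^+ j)))).
  rewrite !big_seq; apply: ler_sum => j jkP.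
  rewrite meanZ; last exact: bdmeas_unsafe.
  have j0 : 0 < 2 ^+ j :> R by rewrite exprn_gt0.
  have ub : \int[mu]_u (unsafe j x u)%:R <=
      (41 * 41)%:R * ((2 ^+ j) ^+ 2)^-1 * empty_bound P k j.
    apply: le_trans (mean_unsafe j x) _; rewrite ler_wpM2l ?(ltW (tx j jkP))//.
  apply: (@le_trans _ _ ((2 ^+ P) ^+ 2 * (((2 ^+ j) ^+ 2)^-1 *
      ((41 * 41)%:R * ((2 ^+ j) ^+ 2)^-1 * empty_bound P k j)))).
    apply: ler_pM => //; last by rewrite ler_wpM2l ?invr_ge0 ?exprn_ge0.
    rewrite mulr_ge0 ?invr_ge0 ?exprn_ge0// Rintegral_ge0//.
  rewrite le_eqVlt; apply/predU1P; left; rewrite /empty_bound.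
  move: (pow2_gt0 R P) j0; move: ((41 * 41)%:R : R) (2 ^+ P) (2 ^+ j) (2 ^+ k) => c p a b p0 a0.
  by field; rewrite !gt_eqF.
rewrite big_split/= -mulr_sumr -mulr_sumr.
have s1 := sum_pow4_le R k P; have s2 := sum_pow2V_le R k P.
have c1 : 0 <= (41 * 41)%:R * (16 * (16 * ((2 ^+ P) ^+ 2)^-1)) :> R.
  by do 3!rewrite mulr_ge0//; rewrite invr_ge0 ltW.
have c2 : 0 <= (41 * 41)%:R * (16 * 2) :> R by rewrite mulr_ge0.
apply: le_trans (lerD (ler_wpM2l c1 s1) (ler_wpM2l c2 s2)) _.
rewrite /weight_bound.
move: (pow2_gt0 R P); move: ((41 * 41)%:R : R) (2 ^+ P) => c p p0.
by rewrite le_eqVlt; apply/predU1P; left; field; rewrite gt_eqF.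
Qed.

(** For theta = 4^P / (16 * 4^j), the condition 4^P <= 8 n gives 2 theta <= n / 4^j, so the
    exponential moment contributes at most 4^j e^(- theta) <= 4^j / theta to the exponent. This is
    theta times the first part of [empty_bound]; what remains is - 2 * 2^j * 2^k. One half of it
    pays for 4^k, the other for 2^j / 2^k, and e^(- x) <= 1/x turns the latter into a factor
    summable over j. *)
Lemma empty_squares_tail P k j n : (k < j <= P)%N -> ((2 ^ P) ^ 2 <= 8 * n)%N ->
  mean_pow mu n (fun x => (empty_bound P k j <= empty_squares j x)%R%:R) <=
  expR (- (2 ^+ k) ^+ 2) * (2 ^+ k / 2 ^+ j).
Proof.
move=> /andP[kj jP] Pn.
have Pn' : (2 ^+ P) ^+ 2 <= 8 * n%:R :> R by rewrite -!natrX -natrM ler_nat.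
pose theta : R := (2 ^+ P) ^+ 2 / (16 * (2 ^+ j) ^+ 2).
have p0 : 0 < 2 ^+ P :> R by exact: pow2_gt0.
have a0 : 0 < 2 ^+ j :> R by exact: pow2_gt0.
have b0 : 0 < 2 ^+ k :> R by exact: pow2_gt0.
have b1 : 1 <= 2 ^+ k :> R by rewrite exprn_ege1// ler1n.
have ba : 2 ^+ k <= 2 ^+ j :> R by rewrite ler_eXn2l ?ltr1n// ltnW.
have th0 : 0 < theta by rewrite divr_gt0 ?mulr_gt0 ?exprn_gt0.
have := empty_count_tail (@measurable_cell_eq R j) (@mu_cell j) n (empty_bound P k j) (ltW th0).
move=> /le_trans; apply.
rewrite card_cells natrM natrX -expr2.
apply: (@le_trans _ _ (expR (- (2 * (2 ^+ j * 2 ^+ k))))).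
  rewrite ler_expR.
  have -> : theta * empty_bound P k j =
      (2 ^+ j) ^+ 2 * theta^-1 + 2 * (2 ^+ j * 2 ^+ k).
    rewrite /theta /empty_bound.
    move: (2 ^+ P) (2 ^+ j) (2 ^+ k) p0 a0 => p a b p0 a0.
    by field; rewrite !gt_eqF.
  rewrite opprD addrA gerDr subr_le0 ler_pM2l ?exprn_gt0//.
  apply: (@le_trans _ _ (expR (- theta))).
    have thE : theta * (2 ^+ j) ^+ 2 = (2 ^+ P) ^+ 2 / 16.
      rewrite /theta; move: (2 ^+ P) (2 ^+ j) a0 => p a a0.
      by field; rewrite gt_eqF.
    suff : theta + theta <= n%:R / (2 ^+ j) ^+ 2 by rewrite ler_expR; lra.
    by rewrite ler_pdivlMr ?exprn_gt0// mulrDl thE; lra.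
  rewrite expRN lef_pV2 ?posrE ?expR_gt0//.
  by apply: le_trans (expR_ge1Dx _); rewrite lerDr.
have -> : 2 ^+ k / 2 ^+ j = (2 ^+ j / 2 ^+ k)^-1 :> R by rewrite invf_div.
apply: (@le_trans _ _ (expR (- (2 ^+ k) ^+ 2) * expR (- (2 ^+ j / 2 ^+ k)))).
  rewrite -expRD ler_expR -opprD lerN2.
  have : 2 ^+ j / 2 ^+ k <= 2 ^+ j * 2 ^+ k :> R.
    rewrite ler_pM2l//; by apply: le_trans (b1); rewrite invf_le1.
  have : (2 ^+ k) ^+ 2 <= 2 ^+ j * 2 ^+ k :> R by rewrite expr2 ler_pM2r.
  by move: (2 ^+ j / 2 ^+ k) (2 ^+ j * 2 ^+ k) ((2 ^+ k) ^+ 2) => a b c; lra.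
rewrite ler_wpM2l ?expR_ge0// expRN lef_pV2 ?posrE ?expR_gt0 ?divr_gt0//.
by apply: le_trans (expR_ge1Dx _); rewrite lerDr.
Qed.

(** Union bound over the levels. The condition on [n] is restricted to k < P because the range of
    levels is empty otherwise. *)
Lemma atypical_le P k n : (k < P -> (2 ^ P) ^ 2 <= 8 * n)%N ->
  mean_pow mu n (fun x => (~~ typical P k x)%:R) <= expR (- (2 ^+ k) ^+ 2).
Proof.
move=> Pn.
have mE j : seqmeas n (fun x => (empty_bound P k j <= empty_squares j x)%R%:R : R).
  apply: bdmeas_bool; apply: measurable_fun_ler; first exact: measurable_cst.
  by case: (seqmeas_empty_count R (@measurable_cell_eq R j) n).
have sumE (x : seq (R * R)) : (~~ typical P k x)%:R <=
    \sum_(k.+1 <= j < P.+1) (empty_bound P k j <= empty_squares j x)%R%:R :> R.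
  have [//|/allPn[j jl]] := boolP (typical P k x); first by rewrite sumr_ge0.
  rewrite -leNgt => xj; rewrite (bigD1_seq j) ?iota_uniq//= xj lerDl sumr_ge0//.
apply: (@le_trans _ _ (\sum_(k.+1 <= j < P.+1)
    mean_pow mu n (fun x => (empty_bound P k j <= empty_squares j x)%R%:R))).
  rewrite -mean_sum//; apply: mean_le => [| |x].
  - by apply: bdmeas_bool; apply: measurable_neg; exact: measurable_typical.
  - exact: bdmeas_sum.
  - exact: sumE.
apply: (@le_trans _ _ (\sum_(k.+1 <= j < P.+1)
    expR (- (2 ^+ k) ^+ 2) * (2 ^+ k / 2 ^+ j))).
  rewrite !big_seq; apply: ler_sum => j; rewrite mem_index_iota ltnS => kjP.
  apply: empty_squares_tail => //; apply: Pn.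
  by case/andP: kjP => /leq_trans; apply.
by rewrite -mulr_sumr -[leRHS]mulr1 ler_wpM2l ?expR_ge0// sum_pow2V_le.
Qed.

End typical_configurations.

(** * Resampling one half *)

Section half_resampling.
Context (R : realType) (mu : probability (R * R)%type R).
Hypothesis mu_uniform : forall A : set (R * R), measurable A ->
  mu A = ((@lebesgue_measure R \x @lebesgue_measure R) (A `&` unit_square R))%E.
Context (kappa : R) (L : {fset R * R} -> R).
Hypothesis mL : measurable_functional L.
Hypothesis regL : dyadic_regular kappa L.
Hypothesis kappa0 : 0 < kappa.
Implicit Types (x y z : seq (R * R)) (k n m P : nat).

Lemma mean_mul m (f g : seq (R * R) -> R) : seqmeas m f -> seqmeas m g ->
  mean_pow mu m (fun y => mean_pow mu m (fun z => f y * g z)) =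
  mean_pow mu m f * mean_pow mu m g.
Proof.
move=> mf mg; rewrite mulrC -[RHS]meanZ//.
by apply: eq_Rintegral => y _; rewrite [LHS]meanZ// mulrC.
Qed.

Lemma seqmeas_catl n m f x : size x = n -> seqmeas (n + m) f ->
  seqmeas m (fun y => f (x ++ y) : R).
Proof.
move=> xn mf; have xn' : size x == n by rewrite xn.
exact: (bdmeas_pair1 (Tuple xn') (seqmeas_cat mf)).
Qed.

Lemma resampling_typical P k n m x : (k <= P)%N -> (m <= (2 ^ P) ^ 2)%N ->
  size x = n -> typical P k x ->
  mean_pow mu m (fun y => mean_pow mu m (fun z =>
    (2 * kappa * (2 * weight_bound R + 1) * 2 ^+ k <=
       augmented L k (x ++ y) - augmented L k (x ++ z))%R%:R)) <=
  expR (- (2 ^+ k) ^+ 2).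
Proof.
move=> kP mP xn tx.
(* A point changes the augmented functional by at most kappa 2^-k, hence [f] by at most 1/2, within
   the limit 2^-1 on the squared difference in [mean_pow_exp_mul]. *)
pose lambda : R := 2 ^+ k / (2 * kappa).
pose f y := lambda * augmented L k (x ++ y).
pose q u := (2 ^+ k) ^+ 2 / 4 * weight P k x u.
have b0 : 0 < 2 ^+ k :> R := pow2_gt0 R k.
have l0 : 0 < lambda by rewrite divr_gt0// mulr_gt0.
have lk : lambda * kappa = 2 ^+ k / 2.
  by rewrite /lambda; move: (2 ^+ k) => b; field; rewrite gt_eqF.
have mf : seqmeas m f.
  apply: bdmeasZ; apply: (seqmeas_catl (n := n)) => //.
  exact: (seqmeas_augmented regL kappa0).
have Phi : mean_pow mu m (fun s => expR (f s)) * mean_pow mu m (fun s => expR (- f s)) <=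
    expR (2 * weight_bound R * (2 ^+ k) ^+ 2).
  apply: (@le_trans _ _ ((1 + 8 * \int[mu]_u q u) ^+ m)).
    apply: mean_pow_exp_mul => //.
    - by apply: bdmeasZ; exact: bdmeas_weight.
    - by move=> u; rewrite mulr_ge0 ?weight_ge0// divr_ge0 ?exprn_ge0.
    - move=> s1 u v s2 _; rewrite -mulrBr exprMn.
      have := augmented_diff regL kappa0 x s1 u v s2 kP.
      rewrite minr_pMr ?exprn_ge0 ?(ltW kappa0)// le_min => /andP[d1 d2].
      have l2 : lambda ^+ 2 * kappa ^+ 2 = (2 ^+ k) ^+ 2 / 4.
        by rewrite -exprMn lk; move: (2 ^+ k) => b; field.
      rewrite le_min; apply/andP; split.
        apply: le_trans (ler_wpM2l (exprn_ge0 2 (ltW l0)) d1) _.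
        rewrite mulrA l2 /q.
        by move: (weight P k x u) (weight P k x v) ((2 ^+ k) ^+ 2) => a b c; lra.
      apply: le_trans (ler_wpM2l (exprn_ge0 2 (ltW l0)) d2) _.
      rewrite mulrA l2 mulrAC divff ?gt_eqF ?exprn_gt0//; lra.
  have Q0 : 0 <= \int[mu]_u q u.
    by apply: Rintegral_ge0 => u _; rewrite mulr_ge0 ?weight_ge0// divr_ge0 ?exprn_ge0.
  apply: (@le_trans _ _ (expR (8 * \int[mu]_u q u) ^+ m)).
    by apply: lerXn2r; rewrite ?nnegrE ?expR_ge0 ?expR_ge1Dx// addr_ge0// mulr_ge0.
  rewrite -expRM_natl ler_expR meanZ; last exact: bdmeas_weight.
  have := typical_mean_weight mu_uniform mP tx.
  have c0 : 0 <= (2 ^+ k) ^+ 2 :> R by rewrite exprn_ge0 ?ltW.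
  move: (\int[mu]_u _) (weight_bound R) ((2 ^+ k) ^+ 2) c0 (m%:R : R) => w W c c0 m' mw.
  have := ler_wpM2l (mulr_ge0 (ler0n R 2) c0) mw.
  by rewrite (_ : m' * _ = 2 * c * (m' * w)); [lra|field].
set t' := 2 * kappa * _ * _.
(* The exponential moments use up 2 [weight_bound] times 4^k; the extra 1 leaves the exponent -
   4^k. *)
have lt' : lambda * t' = (2 * weight_bound R + 1) * (2 ^+ k) ^+ 2.
  rewrite (_ : lambda * t' = (lambda * kappa) * 2 * (2 * weight_bound R + 1) * 2 ^+ k); last first.
    by rewrite /t'; ring.
  by rewrite lk; move: (2 ^+ k) (weight_bound R) => b W; field.
have mef : seqmeas m (fun y => expR (f y)) by exact: bdmeas_expR.
have meNf : seqmeas m (fun y => expR (- f y)).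
  by apply: bdmeas_expR; exact: bdmeasN.
have maug : seqmeas m (fun y => augmented L k (x ++ y)).
  by apply: (seqmeas_catl (n := n)) => //; exact: (seqmeas_augmented regL kappa0).
have mexp2 : bdmeas (fun yz : m.-tuple (R * R) * m.-tuple (R * R) =>
    expR (f yz.1) * expR (- f yz.2)).
  apply: bdmeasM; first exact: (bdmeas_comp mef measurable_fst).
  exact: (bdmeas_comp meNf measurable_snd).
have mind2 : bdmeas (fun yz : m.-tuple (R * R) * m.-tuple (R * R) =>
    (t' <= augmented L k (x ++ yz.1) - augmented L k (x ++ yz.2))%R%:R : R).
  apply: bdmeas_bool; apply: measurable_fun_ler; first exact: measurable_cst.
  apply: measurable_funB.
    exact: (bdmeas_comp maug measurable_fst).1.
  exact: (bdmeas_comp maug measurable_snd).1.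
apply: (@le_trans _ _ (expR (- (lambda * t')) *
    (mean_pow mu m (fun y => expR (f y)) * mean_pow mu m (fun y => expR (- f y))))).
  rewrite -mean_mul// -meanZ; last exact: (bdmeas_mean (tuple_power mu m) _ mexp2).
  apply: mean_le => [| |y].
  - exact: (bdmeas_mean (tuple_power mu m) _ mind2).
  - by apply: bdmeasZ; exact: (bdmeas_mean (tuple_power mu m) _ mexp2).
  rewrite -meanZ; last exact: (bdmeas_pair1 y mexp2).
  apply: mean_le => [| |z].
  - exact: (bdmeas_pair1 y mind2).
  - by apply: bdmeasZ; exact: (bdmeas_pair1 y mexp2).
  rewrite -!expRD; have [tle|_] := leP t'; last exact: expR_ge0.
  rewrite -[leLHS]expR0 ler_expR /f -mulrBr addrC subr_ge0 ler_pM2l//.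
apply: le_trans (ler_wpM2l (expR_ge0 _) Phi) _.
by rewrite -expRD ler_expR lt'; move: (weight_bound R) ((2 ^+ k) ^+ 2) => W c; lra.
Qed.

Let threshold k : R := 2 * kappa * (2 * weight_bound R + 1) * 2 ^+ k.

Lemma bdmeas_resampling k n m :
  bdmeas (fun xyz : (n.-tuple (R * R) * m.-tuple (R * R)) * m.-tuple (R * R) =>
    (threshold k <= augmented L k (xyz.1.1 ++ xyz.1.2) -
                    augmented L k (xyz.1.1 ++ xyz.2))%R%:R : R).
Proof.
have maug := seqmeas_cat (seqmeas_augmented regL kappa0 (n + m) k mL).
apply: bdmeas_bool; apply: measurable_fun_ler; first exact: measurable_cst.
apply: measurable_funB; first exact: (bdmeas_comp maug measurable_fst).1.
apply: (bdmeas_comp (h := fun xyz => (xyz.1.1, xyz.2)) maug _).1.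
by apply: measurable_fun_pair => //; apply: measurableT_comp.
Qed.

Lemma resampling P k n m : (k <= P)%N -> (m <= (2 ^ P) ^ 2)%N ->
  (k < P -> (2 ^ P) ^ 2 <= 8 * n)%N ->
  mean_pow mu n (fun x => mean_pow mu m (fun y => mean_pow mu m (fun z =>
    (threshold k <= augmented L k (x ++ y) - augmented L k (x ++ z))%R%:R))) <=
  2 * expR (- (2 ^+ k) ^+ 2).
Proof.
move=> kP mP nP.
have mtyp : bdmeas (fun x : n.-tuple (R * R) => (~~ typical P k x)%:R : R).
  by apply: bdmeas_bool; apply: measurable_neg; exact: measurable_typical.
have b1 := bdmeas_mean (tuple_power mu n \x tuple_power mu m)%E (tuple_power mu m)
  (bdmeas_resampling k n m).
have b2 := bdmeas_mean (tuple_power mu n) (tuple_power mu m) b1.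
apply: (@le_trans _ _ (mean_pow mu n (fun x =>
    (~~ typical P k x)%:R + expR (- (2 ^+ k) ^+ 2)))); last first.
  rewrite [leLHS]meanD//; last exact: bdmeas_cst.
  by rewrite mean_cst mulrDl mul1r lerD2r; exact: atypical_le.
apply: mean_le => [||x]; first exact: b2.
  by apply: bdmeasD => //; exact: bdmeas_cst.
have [tx|_] /= := boolP (typical P k x).
  by rewrite add0r; apply: (resampling_typical (P := P) (n := n)); rewrite ?size_tuple.
apply: (@le_trans _ _ 1); last by rewrite lerDl expR_ge0.
rewrite -[leRHS](mean_cst (tuple_power mu m)); apply: mean_le.
- exact: (bdmeas_pair1 x b1).
- exact: bdmeas_cst.
move=> y; rewrite -[leRHS](mean_cst (tuple_power mu m)); apply: mean_le.
- exact: (bdmeas_pair1 (x, y) (bdmeas_resampling k n m)).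
- exact: bdmeas_cst.
- by move=> z; case: (threshold k <= _).
Qed.

Lemma seqmeas_level N (p : R -> bool) : measurable_fun setT p ->
  seqmeas N (fun s => (p (L (points s)))%:R : R).
Proof.
move=> mp; apply: bdmeas_bool; apply: measurableT_comp => //.
rewrite (_ : (fun _ => _) = fun s : N.-tuple (R * R) => L (points (s ++ [::]))).
  exact: measurable_points.
by apply/funext => s; rewrite cats0.
Qed.

(** The sample x1 ++ x2 is compared with an independent y2 ++ y1 through the mixture of x1 and y2,
    which is the same set in either order: x2 is resampled with x1 frozen, then x1 with y2 frozen,
    whence two thresholds and two scales [P] and [P']. Adding and removing the grid at both ends
    accounts for 4 kappa 2^k. *)
Lemma two_sample P P' k n m (M : R) : (0 < n + m)%N ->
  (k <= P)%N -> (m <= (2 ^ P) ^ 2)%N -> (k < P -> (2 ^ P) ^ 2 <= 8 * n)%N ->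
  (k <= P')%N -> (n <= (2 ^ P') ^ 2)%N -> (k < P' -> (2 ^ P') ^ 2 <= 8 * m)%N ->
  mean_pow mu (n + m) (fun s => (M + (4 * kappa * 2 ^+ k + 2 * threshold k) <= L (points s))%R%:R) *
  mean_pow mu (n + m) (fun s => (L (points s) <= M)%R%:R) <=
  4 * expR (- (2 ^+ k) ^+ 2).
Proof.
move=> nm0 kP mP nP kP' nP' mP'; set t := 4 * _ * _ + _.
pose A s : R := (M + t <= L (points s))%R%:R.
pose B s : R := (L (points s) <= M)%R%:R.
have mA N : seqmeas N A.
  by apply: (seqmeas_level N (p := fun r => M + t <= r)); apply: measurable_fun_ler => //; exact: measurable_cst.
have mB N : seqmeas N B.
  by apply: (seqmeas_level N (p := fun r => r <= M)); apply: measurable_fun_ler => //; exact: measurable_cst.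
pose I1 x y z : R := (threshold k <= augmented L k (x ++ y) - augmented L k (x ++ z))%R%:R.
have AB (x1 x2 y2 y1 : seq (R * R)) : size (x1 ++ x2) = (n + m)%N ->
    size (y2 ++ y1) = (n + m)%N ->
    A (x1 ++ x2) * B (y2 ++ y1) <= I1 x1 x2 y2 + I1 y2 x1 y1.
  move=> sx sy; rewrite /A /B /I1.
  have [hA|_] := leP (M + t); last by rewrite mul0r addr_ge0.
  have [hB|_] := leP _ M; last by rewrite mulr0 addr_ge0.
  have nx : x1 ++ x2 != [::] by rewrite -size_eq0 sx -lt0n.
  have ny : y2 ++ y1 != [::] by rewrite -size_eq0 sy -lt0n.
  have := augmented_near regL kappa0 k nx; have := augmented_near regL kappa0 k ny.
  rewrite !ler_norml => /andP[ny1 ny2] /andP[nx1 nx2].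
  have E : augmented L k (x1 ++ y2) = augmented L k (y2 ++ x1).
    by congr L; apply: eq_points => z; rewrite !mem_cat [(z \in x1) || _]orbC.
  rewrite mulr1 E.
  have [_|h1] := leP (threshold k) _; first by rewrite lerDl.
  have [_|h2] := leP (threshold k) _; first by rewrite lerDr.
  exfalso; move: h1 h2 ny1 ny2 nx1 nx2 hA hB; rewrite /t.
  by move: (threshold k) (2 ^+ k : R) => h b; lra.
have J1 := bdmeas_mean (tuple_power mu n \x tuple_power mu m)%E (tuple_power mu m)
  (bdmeas_resampling k n m).
have J2 := bdmeas_mean (tuple_power mu m \x tuple_power mu n)%E (tuple_power mu n)
  (bdmeas_resampling k m n).
have J2' : bdmeas (fun z : n.-tuple (R * R) * m.-tuple (R * R) =>
    mean_pow mu n (I1 z.2 z.1)).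
  have mswap : measurable_fun setT
    (fun z : n.-tuple (R * R) * m.-tuple (R * R) => (z.2, z.1)).
    exact: measurable_fun_pair.
  exact: (bdmeas_comp J2 mswap).
have J3 := bdmeas_mean (tuple_power mu n) (tuple_power mu m) J2'.
pose b : R := mean_pow mu (n + m) B.
have step (x1 : n.-tuple (R * R)) (x2 : m.-tuple (R * R)) :
    A (x1 ++ x2) * b <= mean_pow mu m (I1 x1 x2) +
      mean_pow mu m (fun y2 => mean_pow mu n (I1 y2 x1)).
  have bE : b = mean_pow mu m (fun y2 => mean_pow mu n (fun y1 => B (y2 ++ y1))).
    by rewrite /b addnC mean_pow_cat.
  rewrite bE -[leLHS]meanZ; last exact: seqmeas_mean.
  rewrite -[leRHS]meanD; last 2 first.
  - exact: (bdmeas_pair1 (x1, x2) (bdmeas_resampling k n m)).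
  - exact: (bdmeas_pair1 x1 J2').
  apply: mean_le => [||y2].
  - by apply: bdmeasZ; exact: seqmeas_mean.
  - apply: bdmeasD; first exact: (bdmeas_pair1 (x1, x2) (bdmeas_resampling k n m)).
    exact: (bdmeas_pair1 x1 J2').
  have mBy : bdmeas (fun y1 : n.-tuple (R * R) => B (y2 ++ y1)).
    exact: (bdmeas_pair1 y2 (seqmeas_cat (mB (m + n)%N))).
  have mI : bdmeas (fun y1 : n.-tuple (R * R) => I1 y2 x1 y1).
    exact: (bdmeas_pair1 (y2, x1) (bdmeas_resampling k m n)).
  rewrite -[leLHS]meanZ// -[X in X + _](mean_cst (tuple_power mu n)) -[leRHS]meanD//; last first.
    exact: bdmeas_cst.
  apply: mean_le => [||y1]; first exact: bdmeasZ.
    by apply: bdmeasD => //; exact: bdmeas_cst.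
  by apply: AB; rewrite size_cat !size_tuple// addnC.
have mAb : bdmeas (fun z : n.-tuple (R * R) * m.-tuple (R * R) => A (z.1 ++ z.2) * b).
  by apply: bdmeasMr; exact: (seqmeas_cat (mA (n + m)%N)).
have mAbx := bdmeas_mean (tuple_power mu n) (tuple_power mu m) mAb.
have J1m := bdmeas_mean (tuple_power mu n) (tuple_power mu m) J1.
rewrite -/(b) mulrC -meanZ; last exact: (mA (n + m)%N).
rewrite [leLHS](_ : _ = mean_pow mu n (fun x1 => mean_pow mu m (fun x2 => A (x1 ++ x2) * b))); last first.
  transitivity (mean_pow mu (n + m) (fun s => A s * b)).
    by apply: eq_Rintegral => s _; rewrite mulrC.
  by rewrite mean_pow_cat//; exact: (bdmeasMr b (mA (n + m)%N)).
apply: (@le_trans _ _ (mean_pow mu n (fun x1 => mean_pow mu m (fun x2 => mean_pow mu m (I1 x1 x2)) +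
      mean_pow mu m (fun y2 => mean_pow mu n (I1 y2 x1))))).
  apply: mean_le => [||x1]; [exact: mAbx|exact: bdmeasD|].
  rewrite -[X in _ + X](mean_cst (tuple_power mu m)) -[leRHS]meanD; last 2 first.
  - exact: (bdmeas_pair1 x1 J1).
  - exact: bdmeas_cst.
  apply: mean_le => [||x2]; last exact: step.
    exact: (bdmeas_pair1 x1 mAb).
  by apply: bdmeasD; [exact: (bdmeas_pair1 x1 J1)|exact: bdmeas_cst].
rewrite [leLHS]meanD//.
have T1 := resampling kP mP nP; have T2 := resampling kP' nP' mP'.
apply: le_trans (lerD T1 _) (_ : _ + 2 * expR (- (2 ^+ k) ^+ 2) <= _); last by lra.
apply: le_trans T2.
by rewrite [leLHS](mean_swap _ _ J2').
Qed.

End half_resampling.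

(** * Deviation from the median *)

Definition deviation_constant (R : realType) (kappa : R) : R :=
  kappa * (4 + 4 * (2 * weight_bound R + 1)).

(** With p least such that m <= 4^p, a positive p gives 4^(p-1) < m <= n + 1, hence n >= 1 and 4^p <
    4 (n + 1) <= 8 n. The case N = 1, where n = 0, has p = 0. *)
Lemma dyadic_halving N : (1 <= N)%N -> exists p n m : nat,
  [/\ N = (n + m)%N, (n <= m <= (2 ^ p) ^ 2)%N & (0 < p -> (2 ^ p) ^ 2 <= 8 * n)%N].
Proof.
move=> N0; set n := N./2; set m := (N - n)%N.
have nN : (n <= N)%N by rewrite /n; lia.
have exp : exists p, (m <= (2 ^ p) ^ 2)%N.
  exists m; apply: leq_trans (ltnW (ltn_expl m (ltnSn 1))) _.
  by rewrite -mulnn leq_pmulr// expn_gt0.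
case: (ex_minnP exp) => p mp pmin; exists p, n, m; split.
- by rewrite subnKC.
- by rewrite mp andbT /m /n; lia.
case: p mp pmin => // p mp pmin _.
have : ~~ (m <= (2 ^ p) ^ 2)%N by apply/negP => /pmin; rewrite ltnn.
rewrite -ltnNge (expnS 2 p) expnMn; set e := ((2 ^ p) ^ 2)%N.
have : (0 < e)%N by rewrite !expn_gt0.
by rewrite /m /n; lia.
Qed.

Section tail.
Context (R : realType) (kappa : R) (L : {fset R * R} -> R).
Hypothesis mL : measurable_functional L.
Hypothesis regL : dyadic_regular kappa L.
Hypothesis kappa0 : 0 < kappa.

Lemma upper_tail N (d : measure_display) (T : measurableType d) (P : probability T R)
    (X : 'I_N -> {RV P >-> (R * R)%type}) (M : R) k : (1 <= N)%N ->
  mutually_independent P X -> (forall i, uniform_on_unit_square P (X i)) ->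
  let LN := fun w : T => L (point_set (fun i => X i w)) in
  ((2^-1)%:E <= P [set w | (LN w <= M)%R])%E ->
  measurable_fun setT LN /\
  (P [set w | (M + deviation_constant kappa * 2 ^+ k <= LN w)%R] <=
   (8 * expR (- (2 ^+ k) ^+ 2))%:E)%E.
Proof.
move=> N1 indep unif LN med.
pose mu := distribution P (X (Ordinal N1)).
have mu_uniform A : measurable A ->
    mu A = ((@lebesgue_measure R \x @lebesgue_measure R) (A `&` unit_square R))%E.
  exact: (unif (Ordinal N1)).2.
have law i A : measurable A -> distribution P (X i) A = mu A.
  by move=> mA; rewrite (unif i).2// -mu_uniform.
have LNE w : LN w = L (points [tuple X i w | i < N]).
  congr L; apply/fsetP => u; rewrite in_points; apply/imfsetP/mapP => [[i _ ->]|[v]].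
    exists (X i w); first by apply/tnthP; exists i; rewrite tnth_mktuple.
    by rewrite clamp_id//; exact: (unif i).1.
  move=> /tnthP[i ->] ->; exists i => //.
  by rewrite tnth_mktuple clamp_id//; exact: (unif i).1.
have lawN (p : R -> bool) : measurable_fun setT p ->
    P [set w | p (LN w)] = (mean_pow mu N (fun s => (p (L (points s)))%:R))%:E.
  move=> mp.
  have mps : measurable_fun setT (fun s : N.-tuple (R * R) => p (L (points s))).
    apply: measurableT_comp => //.
    rewrite (_ : (fun _ => _) = fun s : N.-tuple (R * R) => L (points (s ++ [::]))).
      exact: measurable_points.
    by apply/funext => s; rewrite cats0.
  rewrite [X in _ = X%:E](mean_bool (tuple_power mu N) mps) fineK; last first.
    by apply: fin_num_measure; rewrite -[X in measurable X]setTI; exact: mps.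
  rewrite -(independent_law indep law); last first.
    by rewrite -[X in measurable X]setTI; exact: mps.
  by congr (P _); apply/seteqP; split => w /=; rewrite LNE.
split.
  rewrite (_ : LN = (fun s : N.-tuple (R * R) => L (points (s ++ [::]))) \o
      (fun w => [tuple X i w | i < N])); last first.
    by apply/funext => w /=; rewrite LNE cats0.
  apply: measurableT_comp; first exact: measurable_points.
  apply/measurable_fun_tnthP => i.
  rewrite (_ : _ \o _ = X i); first exact: measurable_funPT.
  by apply/funext => w /=; rewrite tnth_mktuple.
have [p [n [m [Nnm /andP[nm mp] np]]]] := dyadic_halving N1.
(* The finest level is [maxn p k]: for deviations beyond the scale of the sample it equals [k], and
   the lower bounds on the halves become vacuous. *)
have kp : (k <= maxn p k)%N by rewrite leq_maxr.
have mP : (m <= (2 ^ maxn p k) ^ 2)%N.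
  by apply: leq_trans mp _; rewrite leq_exp2r// leq_exp2l// leq_maxl.
have nP : (k < maxn p k -> (2 ^ maxn p k) ^ 2 <= 8 * n)%N.
  rewrite leq_max ltnn orbF => kp'; rewrite (maxn_idPl (ltnW kp')); apply: np.
  exact: leq_ltn_trans kp'.
have mP' : (k < maxn p k -> (2 ^ maxn p k) ^ 2 <= 8 * m)%N.
  by move=> /nP /leq_trans; apply; rewrite leq_mul2l.
have nm0 : (0 < n + m)%N by rewrite -Nnm.
have two := two_sample mu_uniform mL regL kappa0 M nm0 kp mP nP kp (leq_trans nm mP) mP'.
rewrite (lawN (fun r => M + deviation_constant kappa * 2 ^+ k <= r)); last first.
  by apply: measurable_fun_ler => //; exact: measurable_cst.
move: med; rewrite (lawN (fun r => r <= M)); last first.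
  by apply: measurable_fun_ler => //; exact: measurable_cst.
rewrite !lee_fin => med; rewrite -Nnm in two.
move: two; rewrite (_ : 4 * kappa * _ + _ = deviation_constant kappa * 2 ^+ k); last first.
  by rewrite /deviation_constant; ring.
set a := mean_pow _ _ _; set b := mean_pow _ _ _ in med *.
have a0 : 0 <= a by apply: Rintegral_ge0 => s _.
have := expR_ge0 (- (2 ^+ k) ^+ 2 : R).
move: (expR _) => e e0 ab; have : a * 2^-1 <= a * b by rewrite ler_wpM2l.
by lra.
Qed.

End tail.

Lemma dyadic_regularN (R : realType) (kappa : R) (L : {fset R * R} -> R) :
  dyadic_regular kappa L -> dyadic_regular kappa (fun F => - L F).
Proof.
move=> regL k C F G k1 CC Fsq Fm GC.
by rewrite -opprD normrN; exact: (regL k C F G).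
Qed.

Lemma dyadic_regular_le (R : realType) (kappa kappa' : R) (L : {fset R * R} -> R) :
  kappa <= kappa' -> dyadic_regular kappa L -> dyadic_regular kappa' L.
Proof.
move=> kk regL k C F G k1 CC Fsq Fm GC.
apply: le_trans (regL k C F G k1 CC Fsq Fm GC) _.
by rewrite -!mulrA ler_wpM2r// mulr_ge0// exprz_ge0.
Qed.

Theorem theorem11p3p2 (R : realType) (kappa : R) :
  exists K : R, 0 < K /\
    forall L : {fset R * R} -> R,
      measurable_functional L ->
      dyadic_regular kappa L ->
      forall N : nat, (1 <= N)%N ->
      forall (d : measure_display) (T : measurableType d) (P : probability T R)
        (X : 'I_N -> {RV P >-> (R * R)%type}),
        mutually_independent P X ->
        (forall i, uniform_on_unit_square P (X i)) ->
        let LN := fun w : T => L (point_set (fun i => X i w)) in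
        forall M : R, is_median P LN M ->
        forall t : R, 0 <= t ->
          (P [set w | (t <= `|LN w - M|)%R] <= (K * expR (- t ^+ 2 / K))%:E)%E.
Proof.
(* [kappa] is an arbitrary real number; enlarging it keeps regularity and makes it positive. *)
pose kappa' := `|kappa| + 1; pose c := deviation_constant kappa'.
have k0 : 0 < kappa' by rewrite ltr_wpDl.
have W0 : 0 <= weight_bound R by rewrite addr_ge0// mulr_ge0.
have c0 : 0 < c by rewrite mulr_gt0//; move: (weight_bound R) W0 => W W0; lra.
have cc0 : 0 < c ^+ 2 by rewrite exprn_gt0.
(* 16 collects two tails with factor 8. The bound t < 2 c 2^k turns e^(- 4^k) into e^(- t^2 / (4
   c^2)). For t < c the claimed bound exceeds 1, since K e^(- t^2 / K) >= K - t^2. *)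
exists (16 + 4 * c ^+ 2); split; first by lra.
set K := _ + _; have K16 : 16 <= K by rewrite /K; lra.
move=> L mL regL N N1 d T P X indep unif LN M [med1 med2] t t0.
have {}regL : dyadic_regular kappa' L.
  by apply: dyadic_regular_le regL; rewrite (le_trans (ler_norm _))// lerDl.
have [mLN _] := upper_tail mL regL k0 0 N1 indep unif med1.
have mset (f : T -> R) (r : R) : measurable_fun setT f -> measurable [set w | r <= f w].
  move=> mf; rewrite -[X in measurable X]setTI.
  have mle := measurable_fun_ler (measurable_cst r) mf.
  by apply: (mle measurableT [set true]).
have mdev : measurable [set w | t <= `|LN w - M|].
  apply: mset; apply: measurableT_comp => //.
  by apply: measurable_funB => //; exact: measurable_cst.
have [tc|ct] := ltP t c.
  apply: (@le_trans _ _ 1%E); first exact: probability_le1 mdev.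
  rewrite lee_fin; apply: (@le_trans _ _ (K * (1 + - t ^+ 2 / K))).
    rewrite mulrDr mulr1 mulrC divfK ?gt_eqF//; last by lra.
    by rewrite /K; nra.
  by rewrite ler_wpM2l ?expR_ge1Dx//; lra.
have exk : exists k, t < c * 2 ^+ k.+1.
  exists (Num.truncn (t / c)); rewrite -ltr_pdivrMl// mulrC.
  apply: lt_trans (truncnS_gt _) _.
  by rewrite -natrX ltr_nat ltn_expl.
case: (ex_minnP exk) => k tk kmin.
have kt : c * 2 ^+ k <= t.
  case: k tk kmin => [_ _|k _ kmin]; first by rewrite expr0 mulr1.
  by rewrite leNgt; apply/negP => /kmin; rewrite ltnn.
(* The lower tail is the upper tail of - L, which is regular with the same constant and has median -
   M. *)
have mNL : measurable_functional (fun F => - L F).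
  by move=> n; exact: (measurable_funN (mL n)).
have [_ up] := upper_tail mL regL k0 k N1 indep unif med1.
have med2' : ((2^-1)%:E <= P [set w | (- LN w <= - M)%R])%E.
  by rewrite (_ : [set _ | _] = [set w | (M <= LN w)%R])//; apply/funext => w /=; rewrite lerN2.
have [mLN' down] := upper_tail mNL (dyadic_regularN regL) k0 k N1 indep unif med2'.
apply: (@le_trans _ _ (P ([set w | (M + c * 2 ^+ k <= LN w)%R] `|`
    [set w | (- M + c * 2 ^+ k <= - LN w)%R]))).
  apply: le_measure; rewrite ?inE.
  - exact: mdev.
  - by apply: measurableU; apply: mset.
  - move=> w /=; rewrite ler_normr => /orP[h|h]; [left|right]; lra.
apply: le_trans (measureU2 _ _ _) _; [exact: mset|exact: mset|].
apply: le_trans (leeD up down) _.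
rewrite -EFinD lee_fin -mulrDl.
apply: ler_pM; rewrite ?expR_ge0//; first by lra.
rewrite ler_expR mulNr lerN2 ler_pdivrMr; last by lra.
apply: (@le_trans _ _ ((c * 2 ^+ k.+1) ^+ 2)).
  by rewrite lerXn2r ?nnegrE// ltW// (le_lt_trans t0).
rewrite (exprS 2 k) /K; move: (2 ^+ k : R) => b.
by have := sqr_ge0 b; nra.
Qed.
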